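(* For every integer $d \geq 3$ there exists a constant $c_d > 0$, depending only on $d$, such that the following holds. Let $\varepsilon \in (0,1)$, $n_1, \ldots, n_d \in \mathbb{N}$, and $$r = \left\lceil \frac{c_d}{\varepsilon^2} \log(2e \cdot n_1 \cdots n_d) \right\rceil.$$ Let $R > 0$, let $\Omega \subset \mathbb{R}$ be an interval with $[-R^d, R^d] \subseteq \Omega$, and let $h : \Omega \to \mathbb{R}$ be a bounded function in $C^\infty(\Omega)$ such that, for some constants $C \geq 0$ and $M > 0$, $\|h^{(s)}\|_{L_\infty(\Omega)} \leq C M^s$ for all $s \in \mathbb{N}_0$. Then for every $m \in \mathbb{N}$, every tensor $\mathcal{F} \in \mathbb{R}^{n_1 \times \cdots \times n_d}$ of the form $$\mathcal{F}(i_1, \ldots, i_d) = h\big(\langle x^{(1)}_{i_1}, \ldots, x^{(d)}_{i_d} \rangle\big)$$ with points $\{x^{(j)}_{i_j}\}_{i_j=1}^{n_j} \subset \overline{\mathbb{B}}_{m,R}$, $j = 1, \ldots, d$, and every integer $t \geq e^2 M R^d$, there exists $\mathcal{G} \in \mathbb{R}^{n_1 \times \cdots \times n_d}$ with $\mathrm{rank_{TT}}(\mathcal{G}) \preccurlyeq 1 + (t-1) r$ such that $$\|\mathcal{F} - \mathcal{G}\|_{\max} \leq C \left[ e^{-t} + \varepsilon \left( e^{M R^d} - 1 \right) \right].$$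
   Context: $\mathbb{N} = \{1,2,\ldots\}$ and $\mathbb{N}_0 = \{0,1,2,\ldots\}$; $\log$ is the natural logarithm and $e$ is Euler's number. $\overline{\mathbb{B}}_{m,R} = \{x \in \mathbb{R}^m : \|x\|_2 \leq R\}$. For $x^{(1)}, \ldots, x^{(d)} \in \mathbb{R}^m$, the higher-order inner product is $\langle x^{(1)}, \ldots, x^{(d)} \rangle = \sum_{\alpha=1}^m \prod_{j=1}^d x^{(j)}(\alpha)$. The maximum norm $\|\mathcal{F}\|_{\max}$ is the largest absolute value of the entries of $\mathcal{F}$. A tensor-train (TT) decomposition of $\mathcal{F}$ of TT rank $(r_1, \ldots, r_{d-1}) \in \mathbb{N}^{d-1}$ is a representation $$\mathcal{F}(i_1, \ldots, i_d) = \sum_{\alpha_1=1}^{r_1} \cdots \sum_{\alpha_{d-1}=1}^{r_{d-1}} \mathcal{G}_1(1,i_1,\alpha_1)\, \mathcal{G}_2(\alpha_1,i_2,\alpha_2) \cdots \mathcal{G}_d(\alpha_{d-1},i_d,1)$$ with real arrays $\mathcal{G}_j$ of size $r_{j-1} \times n_j \times r_j$ ($r_0 = r_d = 1$); $\mathrm{rank_{TT}}(\mathcal{F})$ is the componentwise smallest TT rank among all TT decompositions of $\mathcal{F}$. For a tuple and a number, $(r_1, \ldots, r_{d-1}) \preccurlyeq \rho$ means $r_s \leq \rho$ for every $s$. For a function $g$ on $\Omega$, $\|g\|_{L_\infty(\Omega)} = \sup_{x \in \Omega} |g(x)|$, and $h^{(s)}$ is the $s$-th derivative of $h$. *)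

(* Defs.v *)
From HB Require Import structures.
From mathcomp Require Import all_boot all_order all_algebra.
From mathcomp Require Import all_classical all_reals all_analysis.

Set Implicit Arguments.
Unset Strict Implicit.
Unset Printing Implicit Defensive.

Import Order.TTheory GRing.Theory Num.Theory.
Import numFieldNormedType.Exports.

Local Open Scope classical_set_scope.
Local Open Scope ring_scope.

Section smooth_functions_on_a_set.
Variable R : realType.
Implicit Types (D : set R) (f : R -> R) (x : R).

(* The difference quotient is taken along points of D only: derivatives at
   endpoints belonging to D are one-sided, and the values of f outside of D
   are irrelevant at points of D. *)
Definition diff_quot f x : R -> R := fun y => (f y - f x) / (y - x).

Definition derivable_within D f x : Prop :=
  cvg (diff_quot f x y @[y --> within D x^']).

Definition derive_within D f : R -> R :=
  fun x => lim (diff_quot f x y @[y --> within D x^']).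

Definition derive_within_n D (s : nat) f : R -> R := iter s (derive_within D) f.

Definition smooth_within D f : Prop :=
  forall s x, D x -> derivable_within D (derive_within_n D s f) x.

(* Extended-real valued: the norm of an unbounded function is +oo, whereas the
   real-valued sup would give 0. *)
Definition Linfty_norm D f : \bar R := ereal_sup [set `|f x|%:E | x in D].

End smooth_functions_on_a_set.

(* The norm that the library puts on 'rV[R]_m is the maximum norm, hence the
   explicit Euclidean norm. *)
Definition closed_eball (R : realType) (m : nat) (rho : R) : set 'rV[R]_m :=
  [set x | Num.sqrt (\sum_(a < m) x ord0 a ^+ 2) <= rho].

Definition hoinner (R : realType) (d m : nat) (x : 'I_d -> 'rV[R]_m) : R :=
  \sum_(a < m) \prod_(j < d) x j ord0 a.

Definition tensor (R : realType) (d : nat) (n : 'I_d -> nat) : Type :=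
  {dffun forall j : 'I_d, 'I_(n j)} -> R.

Definition max_norm (R : realType) (d : nat) (n : 'I_d -> nat)
    (F : tensor R n) : R :=
  \big[Num.max/0]_(i : {dffun forall j : 'I_d, 'I_(n j)}) `|F i|.

Section tensor_train.
Variables (R : realType) (d : nat) (n : 'I_d -> nat).

(* A rank tuple (r_1, ..., r_(d-1)) is stored together with the boundary values
   as r : 'I_d.+1 -> nat, where r_0 = r_d = 1 is imposed in has_TT_rank.  The
   modes being numbered from 0, the j-th core has size r_j x n_j x r_(j+1). *)
Definition TT_cores (r : 'I_d.+1 -> nat) : Type :=
  forall j : 'I_d,
    'I_(r (widen_ord (leqnSn d) j)) -> 'I_(n j) -> 'I_(r (lift ord0 j)) -> R.

(* The sum ranges over all (a_0, a_1, ..., a_d) with a_k < r_k; when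
   r_0 = r_d = 1 the indices a_0 and a_d take a single value. *)
Definition TT_eval (r : 'I_d.+1 -> nat) (G : TT_cores r) : tensor R n :=
  fun i => \sum_(a : {dffun forall k : 'I_d.+1, 'I_(r k)})
    \prod_(j < d) G j (a (widen_ord (leqnSn d) j)) (i j) (a (lift ord0 j)).

Definition has_TT_rank (F : tensor R n) (r : 'I_d.+1 -> nat) : Prop :=
  [/\ r ord0 = 1%N, r ord_max = 1%N, (forall k, (0 < r k)%N)
    & exists G : TT_cores r, F =1 TT_eval G].

Definition is_rank_TT (F : tensor R n) (r : 'I_d.+1 -> nat) : Prop :=
  has_TT_rank F r /\
  forall r', has_TT_rank F r' -> forall k, (r k <= r' k)%N.

End tensor_train.

(* Main.v *)
Require Import Defs.
From mathcomp Require Import all_boot all_order all_algebra.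
From mathcomp Require Import all_classical all_reals all_analysis.
From mathcomp Require Import ring lra.
Set Implicit Arguments.
Unset Strict Implicit.
Unset Printing Implicit Defensive.
Import Order.TTheory GRing.Theory Num.Theory.
Import numFieldNormedType.Exports.
Local Open Scope classical_set_scope.
Local Open Scope ring_scope.

(** Taylor expansion of [h] at 0 up to order [t - 1] costs [C e^(-t)], and the
    s-th power of a higher-order inner product is the higher-order inner product
    of s-th tensor powers, so it suffices to approximate a single higher-order
    inner product of unit vectors up to [eps].  Write
    [<x_1, ..., x_d> = x_1^T D_2 ... D_(d-1) x_d] with [D_j = diag x_j] and insert
    random sign sketches [P_k P_k^T] of rank [r] between consecutive factors, one
    after the other.  Besides the Johnson-Lindenstrauss bound for inner products,
    each step must keep the left vectors bounded: [P P^T u - u] is, coordinate by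
    coordinate, a Rademacher sum of variance [|u|^2 / r], so by convexity of [exp]
    its average with weights [x_j(a)^2] has exponential moments independent of
    [m].  A union bound over the [n_1 ... n_d] multi-indices then needs only
    [r ~ log (n_1 ... n_d) / eps^2].  Finally, the minimal TT rank of a tensor is
    given by the ranks of its unfoldings, which are subadditive. *)

(** * Exponential moments of squared Rademacher sums *)

Lemma MVT_nondecreasing (R : realType) (f df : R -> R) (a b : R) : a <= b ->
  (forall x : R, x \in `]a, b[ -> is_derive x 1 f (df x)) ->
  {within `[a, b], continuous f} ->
  (forall x, x \in `]a, b[ -> 0 <= df x) -> f a <= f b.
Proof.
rewrite le_eqVlt => /predU1P[->//|ab] fdf cf df0.
have [c cab e] := MVT ab fdf cf.
by rewrite -subr_ge0 e mulr_ge0 ?subr_ge0 ?df0// ltW.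
Qed.

Lemma is_derive_nondecreasing (R : realType) (f df : R -> R) (a b : R) :
  a <= b -> (forall x : R, is_derive x 1 f (df x)) ->
  (forall x, x \in `[a, b]%R -> 0 <= df x) -> f a <= f b.
Proof.
move=> ab fdf df0; apply: (MVT_nondecreasing ab (fun x _ => fdf x)).
  apply: continuous_subspaceT => x; apply: differentiable_continuous.
  by apply/derivable1_diffP; case: (fdf x).
by move=> x /subset_itv_oo_cc; exact: df0.
Qed.

(** This is sinh x <= x cosh x: the difference vanishes at 0 and has derivative 2 x sinh x >= 0. It
    gives the sign of the derivative in [cosh_le_expR_sqr]. *)
Lemma expR_sub_opp_le (R : realType) (x : R) : 0 <= x ->
  expR x - expR (- x) <= x * (expR x + expR (- x)).
Proof.
move=> x0.
pose f (x : R) : R := x * (expR x + expR (- x)) - (expR x - expR (- x)).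
suff : f 0 <= f x by rewrite /f oppr0 expR0 mul0r !subrr subr_ge0.
apply: (@is_derive_nondecreasing _ f (fun x => x * (expR x - expR (- x)))) => //.
  move=> z; apply: is_derive_eq.
  by rewrite /GRing.scale /=; ring.
move=> z /[!in_itv]/= /andP[z0 _]; rewrite mulr_ge0// subr_ge0 ler_expR.
by rewrite (le_trans _ z0)// oppr_le0.
Qed.

(** The sub-Gaussian bound for one random sign. By evenness take x >= 0, where cosh x * exp (- x^2 /
    2) is nonincreasing. *)
Lemma cosh_le_expR_sqr (R : realType) (x : R) :
  expR x + expR (- x) <= 2 * expR (x ^+ 2 / 2).
Proof.
wlog x0 : x / 0 <= x.
  move=> H; have [/H//|x0] := leP 0 x.
  by have := H (- x); rewrite opprK addrC sqrrN oppr_ge0 (ltW x0); exact.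
pose f (x : R) : R := - ((expR x + expR (- x)) * expR (- (x ^+ 2 / 2))).
suff : f 0 <= f x.
  rewrite /f oppr0 expr0n/= mul0r oppr0 expR0 mulr1 lerN2.
  by rewrite [expR (- (_ / _))]expRN ler_pdivrMr ?expR_gt0.
apply: (@is_derive_nondecreasing _ f (fun x =>
   (x * (expR x + expR (- x)) - (expR x - expR (- x))) * expR (- (x ^+ 2 / 2)))) => //.
  move=> z; apply: is_derive_eq.
  by rewrite /GRing.scale /=; field.
move=> z /[!in_itv]/= /andP[z0 _]; rewrite mulr_ge0 ?expR_ge0// subr_ge0.
exact: expR_sub_opp_le.
Qed.

(** The cross terms [2 * mu * w * c] occur with opposite signs, and their cosh is absorbed into the
    coefficient of [c ^+ 2]. The sign of [mu] is free because polarization uses both signs. *)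
Lemma expR_sqr_symmetrized_le (R : realType) (mu w c : R) :
  expR (mu * (w + c) ^+ 2) + expR (mu * (- w + c) ^+ 2) <=
  2 * (expR (mu * w ^+ 2) * expR ((mu + 2 * mu ^+ 2 * w ^+ 2) * c ^+ 2)).
Proof.
have -> : mu * (w + c) ^+ 2 = mu * w ^+ 2 + mu * c ^+ 2 + 2 * mu * w * c by ring.
have -> : mu * (- w + c) ^+ 2 = mu * w ^+ 2 + mu * c ^+ 2 - 2 * mu * w * c by ring.
have -> : (mu + 2 * mu ^+ 2 * w ^+ 2) * c ^+ 2 =
  mu * c ^+ 2 + (2 * mu * w * c) ^+ 2 / 2 by field.
rewrite !expRD -mulrDr [leRHS](_ : _ = expR (mu * w ^+ 2) *
  expR (mu * c ^+ 2) * (2 * expR ((2 * mu * w * c) ^+ 2 / 2))); last by ring.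
by rewrite ler_pM2l ?mulr_gt0 ?expR_gt0// cosh_le_expR_sqr.
Qed.

(** Shows that the exponent z + 4 z^2 is stable under adding one sign: the corrections due to [mu']
    are at most 3 a v / 2 + a^2 / 4, inside the 2 a v + a^2 gained when [v] grows to [a + v]. *)
Lemma mgf_exponent_le (R : realFieldType) (mu a v : R) :
  0 <= a -> 0 <= v -> `|mu| * (a + v) <= 4^-1 ->
  let mu' := mu + 2 * mu ^+ 2 * a in
  mu * a + (mu' * v + 4 * (mu' * v) ^+ 2) <=
  mu * (a + v) + 4 * (mu * (a + v)) ^+ 2.
Proof.
move=> a0 v0 hv /=.
have hm : `|mu * v| <= 4^-1.
  by rewrite normrM (ger0_norm v0) (le_trans _ hv)// ler_wpM2l// lerDr.
have : - 4^-1 <= mu * v <= 4^-1 by rewrite -ler_norml.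
move=> /andP[m1 m2].
have -> : 4 * (mu * (a + v)) ^+ 2 = 4 * mu ^+2 * (a+v)^+2 by ring.
have -> : 4 * ((mu + 2 * mu ^+ 2 * a) * v) ^+ 2 =
  4 * mu ^+ 2 * (v ^+2 + 4 * (mu * v) * a * v + 4 * (mu * v)^+ 2 * a ^+ 2) by ring.
have -> : mu * a + ((mu + 2 * mu ^+ 2 * a) * v +
  4 * mu ^+ 2 * (v ^+ 2 + 4 * (mu * v) * a * v + 4 * (mu * v) ^+ 2 * a ^+ 2)) =
  mu * (a + v) + 4 * mu ^+ 2 * (v ^+ 2 + 4 * (mu * v) * a * v + 4 * (mu * v) ^+ 2 * a ^+ 2 + a * v / 2) by field.
rewrite lerD2l; apply: ler_wpM2l; first by rewrite pmulr_rge0// sqr_ge0.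
have av : 0 <= a * v by rewrite mulr_ge0.
have h1 : (mu * v) * (a * v) <= 4^-1 * (a * v) by rewrite ler_wpM2r.
have h2 : (mu * v) ^+ 2 <= 16^-1 by nra.
have h3 : (mu * v) ^+ 2 * a ^+ 2 <= 16^-1 * a ^+ 2 by rewrite ler_wpM2r// sqr_ge0.
have h4 : 0 <= a ^+ 2 by exact: sqr_ge0.
have -> : 4 * (mu * v) * a * v = 4 * ((mu * v) * (a * v)) by ring.
rewrite -[4 * _ * a ^+ 2]mulrA sqrrD.
by lra.
Qed.

Section sign_systems.
Variables (R : realType) (W : finType) (J : eqType).
Variables (sgn : J -> W -> R) (flip : J -> W -> W).

(** Flipping a sign permutes the sample space, so that sums can be symmetrized. Flips that negate
    one sign and fix the others stand in for independence below. *)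
Lemma sum_flip (f : W -> R) (j : J) : injective (flip j) ->
  2 * \sum_w f w = \sum_w (f w + f (flip j w)).
Proof. by move=> inj; rewrite mulr_natl mulr2n {2}(reindex_inj inj) big_split. Qed.

(* Condition on the first sign: averaging over it turns [mu * (w + c)^2] into
   [mu * w^2 + mu' * c^2] with [mu' = mu + 2 * mu^2 * w^2]. *)
Lemma rademacher_sqr_mgf (s : seq J) (w : J -> R) (mu : R) :
  uniq s ->
  {in s, forall j, injective (flip j)} ->
  {in s, forall j x, sgn j (flip j x) = - sgn j x} ->
  {in s &, forall i j, i != j -> forall x, sgn i (flip j x) = sgn i x} ->
  {in s, forall j x, sgn j x ^+ 2 = 1} ->
  `|mu| * \sum_(j <- s) w j ^+ 2 <= 4^-1 ->
  \sum_x expR (mu * (\sum_(j <- s) w j * sgn j x) ^+ 2) <=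
  #|W|%:R * expR (mu * (\sum_(j <- s) w j ^+ 2) +
                  4 * (mu * \sum_(j <- s) w j ^+ 2) ^+ 2).
Proof.
elim: s mu => [|j s IH] mu.
  move=> *; rewrite !big_nil !(mulr0, expr0n, addr0, expR0) mulr1.
  by under eq_bigr do rewrite big_nil expr0n mulr0 expR0; rewrite sumr_const.
move=> /= /andP[js us] inj neg inv sqr; rewrite !big_cons.
have sub i : i \in s -> i \in j :: s by rewrite inE orbC => ->.
set v := \sum_(j <- s) w j ^+ 2 => hv.
have v0 : 0 <= v by apply: sumr_ge0 => i _; exact: sqr_ge0.
have w0 : 0 <= w j ^+ 2 by exact: sqr_ge0.
have m0 : 0 <= `|mu| by [].
pose mu' := mu + 2 * mu ^+ 2 * w j ^+ 2.
have mu2 : mu ^+ 2 = `|mu| ^+ 2 by rewrite real_normK ?num_real.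
(* The smallness condition survives the passage to [mu']: as [|mu| * v] is at most 1/4, the
   increment is at most [|mu| * w j ^+ 2 / 2]. *)
have hmu' : `|mu'| * v <= 4^-1.
  have : `|mu'| <= `|mu| + 2 * `|mu| ^+ 2 * w j ^+ 2.
    rewrite (le_trans (ler_normD _ _))// lerD2l ger0_norm -?mu2//.
    by rewrite mulr_ge0// mulr_ge0// sqr_ge0.
  move=> /(ler_wpM2r v0) /le_trans; apply.
  have mv : 0 <= `|mu| * v by rewrite mulr_ge0.
  have mw : 0 <= `|mu| * w j ^+ 2 by rewrite mulr_ge0.
  have -> : (`|mu| + 2 * `|mu| ^+ 2 * w j ^+ 2) * v =
    `|mu| * v + 2 * ((`|mu| * w j ^+ 2) * (`|mu| * v)) by ring.
  move: hv; rewrite mulrDr => hv.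
  have : (`|mu| * w j ^+ 2) * (`|mu| * v) <= (`|mu| * w j ^+ 2) * 4^-1.
    by rewrite ler_wpM2l//; lra.
  by lra.
rewrite -(@ler_pM2l _ 2)// (sum_flip _ (inj j _)) ?mem_head//.
apply: (@le_trans _ _ (\sum_x 2 * (expR (mu * w j ^+ 2) *
    expR (mu' * (\sum_(i <- s) w i * sgn i x) ^+ 2)))).
  apply: ler_sum => x _; rewrite !big_cons neg ?mem_head//.
  have -> : \sum_(i <- s) w i * sgn i (flip j x) = \sum_(i <- s) w i * sgn i x.
    apply: eq_big_seq => i is_; rewrite (inv i j (sub i is_) (mem_head j s))//.
    by apply: contraNneq js => <-.
  have := expR_sqr_symmetrized_le mu (w j * sgn j x) (\sum_(i <- s) w i * sgn i x).
  by rewrite mulrN exprMn sqr ?mem_head// mulr1.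
rewrite -mulr_sumr ler_pM2l// -mulr_sumr.
have := IH mu' us (fun i h => inj i (sub i h)) (fun i h => neg i (sub i h))
  (fun i k h h' => inv i k (sub i h) (sub k h')) (fun i h => sqr i (sub i h)) hmu'.
move=> /(ler_wpM2l (expR_ge0 (mu * w j ^+ 2))) /le_trans; apply.
rewrite mulrCA ler_wpM2l// -expRD ler_expR -/v /mu'.
exact: mgf_exponent_le.
Qed.

End sign_systems.

Lemma expR_mid_le (R : realType) (a b : R) :
  expR ((a + b) / 2) <= (expR a + expR b) / 2.
Proof.
have -> : a = a / 2 + a / 2 by field.
have -> : b = b / 2 + b / 2 by field.
have -> : (a / 2 + a / 2 + (b / 2 + b / 2)) / 2 = a / 2 + b / 2 by field.
rewrite !expRD; have := sqr_ge0 (expR (a / 2) - expR (b / 2)).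
by rewrite ler_pdivlMr// sqrrB; lra.
Qed.

(** Jensen's inequality with the missing mass of the weights placed at 0, where exp is 1. Sum the
    tangent inequality at the mean [t]. *)
Lemma expR_jensen (R : realType) (A : finType) (w z : A -> R) :
  (forall a, 0 <= w a) -> \sum_a w a <= 1 ->
  expR (\sum_a w a * z a) <= \sum_a w a * expR (z a) + (1 - \sum_a w a).
Proof.
move=> w0 w1; set t := \sum_a w a * z a.
have tangent y : expR t * (1 + (y - t)) <= expR y.
  by rewrite -[X in _ <= expR X](subrKC t) expRD ler_pM2l ?expR_gt0// expR_ge1Dx.
have : \sum_a w a * (expR t * (1 + (z a - t))) <= \sum_a w a * expR (z a).
  by apply: ler_sum => a _; rewrite ler_wpM2l.
have -> : \sum_a w a * (expR t * (1 + (z a - t))) =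
    expR t * ((1 - t) * (\sum_a w a) + t).
  rewrite /t mulr_sumr -big_split mulr_sumr; apply: eq_bigr => a _ /=.
  by rewrite -/t; ring.
have : (1 - \sum_a w a) * (expR t * (1 + (0 - t))) <= (1 - \sum_a w a) * expR 0.
  by rewrite ler_wpM2l ?subr_ge0.
rewrite expR0.
have -> : (1 - \sum_a w a) * (expR t * (1 + (0 - t))) =
  expR t - expR t * ((1 - t) * (\sum_a w a) + t) by ring.
by lra.
Qed.

(** * Random sign vectors and sketches *)

Section random_signs.
Variables (R : realType) (A : finType).
Implicit Types u y : A -> R.

Definition sg (b : bool) : R := (-1) ^+ b.

Lemma sg_sqr b : sg b ^+ 2 = 1.
Proof. by rewrite /sg sqrr_sign. Qed.

Lemma sg_addb b c : sg (b (+) c) = sg b * sg c.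
Proof. by rewrite /sg signr_addb. Qed.

Definition rad (t : {ffun A -> bool}) u : R := \sum_a u a * sg (t a).

Lemma rad_mgf u (mu : R) : `|mu| * \sum_a u a ^+ 2 <= 4^-1 ->
  \sum_t expR (mu * rad t u ^+ 2) <=
  #|{ffun A -> bool}|%:R *
    expR (mu * (\sum_a u a ^+ 2) + 4 * (mu * \sum_a u a ^+ 2) ^+ 2).
Proof.
pose flip a (t : {ffun A -> bool}) := [ffun b => t b (+) (b == a)].
move=> hmu; rewrite /rad.
apply: (@rademacher_sqr_mgf R {ffun A -> bool} A (fun a t => sg (t a)) flip (index_enum A) u mu) => //.
- exact: index_enum_uniq.
- move=> a _; apply: inv_inj => t; apply/ffunP => b; rewrite !ffunE.
  by rewrite -addbA addbb addbF.
- by move=> a _ t; rewrite ffunE eqxx sg_addb /sg expr1 mulrN1.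
- by move=> a b _ _ ab t; rewrite ffunE (negPf ab) addbF.
- by move=> a _ t; exact: sg_sqr.
Qed.

Lemma radD t u y : rad t (fun a => u a + y a) = rad t u + rad t y.
Proof. by rewrite /rad -big_split; apply: eq_bigr => a _; rewrite /= mulrDl. Qed.

Lemma radB t u y : rad t (fun a => u a - y a) = rad t u - rad t y.
Proof. by rewrite /rad -sumrB; apply: eq_bigr => a _; rewrite mulrBl. Qed.

Lemma sum_sqrD u y : \sum_a (u a + y a) ^+ 2 =
  \sum_a u a ^+ 2 + \sum_a y a ^+ 2 + 2 * \sum_a u a * y a.
Proof.
rewrite mulr_sumr -!big_split; apply: eq_bigr => a _ /=; ring.
Qed.

Lemma sum_sqrB u y : \sum_a (u a - y a) ^+ 2 =
  \sum_a u a ^+ 2 + \sum_a y a ^+ 2 - 2 * \sum_a u a * y a.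
Proof.
rewrite mulr_sumr -big_split -sumrB; apply: eq_bigr => a _ /=; ring.
Qed.

(* Polarization reduces the product of two Rademacher sums to two squares. *)
Lemma rad_mul_mgf u y (l : R) :
  \sum_a u a ^+ 2 <= 1 -> \sum_a y a ^+ 2 <= 1 -> `|l| <= 8^-1 ->
  \sum_t expR (l * (rad t u * rad t y - \sum_a u a * y a)) <=
  #|{ffun A -> bool}|%:R * expR (16 * l ^+ 2).
Proof.
move=> u1 y1 hl.
set p := \sum_a (u a + y a) ^+ 2; set q := \sum_a (u a - y a) ^+ 2.
have p0 : 0 <= p by apply: sumr_ge0 => a _; exact: sqr_ge0.
have q0 : 0 <= q by apply: sumr_ge0 => a _; exact: sqr_ge0.
have p4 : p <= 4 by move: q0; rewrite /p /q sum_sqrB sum_sqrD; lra.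
have q4 : q <= 4 by move: p0; rewrite /p /q sum_sqrB sum_sqrD; lra.
(* The constant is 4 * 4^2: the second-order term of [rad_mgf] with a squared norm of at most 4. *)
have half v (mu : R) : `|mu| <= 16^-1 -> \sum_a v a ^+ 2 <= 4 ->
    \sum_t expR (mu * (rad t v ^+ 2 - \sum_a v a ^+ 2)) <=
    #|{ffun A -> bool}|%:R * expR (64 * mu ^+ 2).
  move=> hmu v4; have v0 : 0 <= \sum_a v a ^+ 2.
    by apply: sumr_ge0 => a _; exact: sqr_ge0.
  under eq_bigr do rewrite mulrBr expRD.
  rewrite -mulr_suml expRN ler_pdivrMr ?expR_gt0//.
  have hv : `|mu| * \sum_a v a ^+ 2 <= 4^-1.
    by rewrite (@le_trans _ _ (16^-1 * 4)) ?ler_pM//; lra.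
  rewrite (le_trans (rad_mgf hv))// -mulrA ler_wpM2l// -expRD ler_expR addrC lerD2r.
  rewrite exprMn -[64]/(4 * 16)%:R natrM -mulrA ler_pM2l// mulrC ler_wpM2r ?sqr_ge0//.
  by rewrite -[16]/(4 ^ 2)%:R natrX lerXn2r// nnegrE.
(* By polarization the exponent is the midpoint of the centred squares of u + y and u - y, weighted
   by [l'] and [- l'], so [expR_mid_le] separates them. *)
pose l' := l / 2.
have hl' : `|l'| <= 16^-1.
  by rewrite normrM (@le_trans _ _ (8^-1 / 2)) ?ler_pM// ?ger0_norm//; lra.
have hm := half (fun a => u a + y a) l' hl' p4.
have hn : `|- l'| <= 16^-1 by rewrite normrN.
have {half hn}hn := half (fun a => u a - y a) (- l') hn q4.
have -> : 16 * l ^+ 2 = 64 * l' ^+ 2 by rewrite /l'; field.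
rewrite sqrrN -/p -/q in hm hn.
have : \sum_t expR (l * (rad t u * rad t y - \sum_a u a * y a)) <=
  (\sum_t expR (l' * (rad t (fun a => u a + y a) ^+ 2 - p)) +
   \sum_t expR (- l' * (rad t (fun a => u a - y a) ^+ 2 - q))) / 2.
  rewrite -big_split mulr_suml; apply: ler_sum => t _ /=.
  apply: le_trans (expR_mid_le _ _); rewrite ler_expR le_eqVlt; apply/orP; left.
  by apply/eqP; rewrite /p /q sum_sqrB sum_sqrD radD radB /l'; field.
move/le_trans; apply; rewrite ler_pdivrMr//.
by move: hm hn; lra.
Qed.

End random_signs.

Section sketch.
Variables (R : realType) (A : finType) (r : nat).
Implicit Types u y : A -> R.

Definition signs : finType := {ffun 'I_r -> {ffun A -> bool}}.

Definition sketch_err (s : signs) u y : R :=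
  r%:R^-1 * (\sum_(k < r) rad (s k) u * rad (s k) y) - \sum_a u a * y a.

(** The error is a mean of [r] independent copies, so the sum over [signs] factors into an [r]-th
    power of the single-column moment. *)
Lemma sketch_err_mgf u y (l : R) : (0 < r)%N ->
  \sum_a u a ^+ 2 <= 1 -> \sum_a y a ^+ 2 <= 1 -> `|l| <= 8^-1 ->
  \sum_(s : signs) expR (l * r%:R * sketch_err s u y) <=
  #|signs|%:R * expR (16 * l ^+ 2 * r%:R).
Proof.
move=> r0 u1 y1 hl.
pose phi t := expR (l * (rad t u * rad t y - \sum_a u a * y a)).
have -> : \sum_(s : signs) expR (l * r%:R * sketch_err s u y) =
    \sum_(s : signs) \prod_(k < r) phi (s k).
  apply: eq_bigr => s _; rewrite /phi -expR_sum; congr expR.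
  rewrite -mulr_sumr sumrB sumr_const card_ord /sketch_err -mulr_natl.
  have r0' : r%:R != 0 :> R by rewrite pnatr_eq0 -lt0n.
  by field.
rewrite -(bigA_distr_bigA (fun _ => phi)) prodr_const card_ord.
rewrite card_ffun card_ord natrX mulrC.
have -> : expR (16 * l ^+ 2 * r%:R) = expR (16 * l ^+ 2) ^+ r.
  by rewrite -expRM_natl mulrC.
rewrite mulrC -exprMn lerXn2r ?nnegrE ?mulr_ge0 ?expR_ge0//.
  by apply: sumr_ge0 => t _; exact: expR_ge0.
exact: rad_mul_mgf.
Qed.

Definition sketch_coord_err (s : signs) u (a : A) : R :=
  r%:R^-1 * (\sum_(k < r) sg R (s k a) * rad (s k) u) - u a.

(* The products of the signs at [a] with those at [b != a] are again
   independent signs, so the coordinate error is itself a Rademacher sum. *)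
Lemma sketch_coord_err_mgf u (a : A) : (0 < r)%N -> \sum_a u a ^+ 2 <= 1 ->
  \sum_(s : signs) expR (r%:R / 4 * sketch_coord_err s u a ^+ 2) <=
  #|signs|%:R * expR 2^-1.
Proof.
move=> r0 u1; pose J := ('I_r * A)%type.
have r0' : r%:R != 0 :> R by rewrite pnatr_eq0 -lt0n.
(* The pairs with [j.2 = a] carry the square of a sign; together they contribute exactly [u a],
   which the error subtracts. *)
pose js := [seq j <- index_enum J | j.2 != a].
pose sgn (j : J) (s : signs) : R := sg R (s j.1 a) * sg R (s j.1 j.2).
(* For [j = (k, b)] with [b != a], changing the sign at [b] in column [k] negates the product at [j]
   and no other product in [js]. *)
pose flip (j : J) (s : signs) : signs :=
  [ffun k => [ffun b => s k b (+) ((k, b) == j)]].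
pose w (j : J) := u j.2 / r%:R.
have errE s : sketch_coord_err s u a = \sum_(j <- js) w j * sgn j s.
  rewrite /js big_filter /= -(pair_big xpredT (fun b => b != a)
    (fun k b => w (k, b) * sgn (k, b) s))/= /sketch_coord_err.
  have -> : u a = r%:R^-1 * \sum_(k < r) u a.
    by rewrite sumr_const card_ord -[u a *+ r]mulr_natr; field.
  rewrite -mulrBr -sumrB mulr_sumr; apply: eq_bigr => k _.
  rewrite /rad (bigD1 a)//= [sg R _ * (_ + _)]mulrDr [_ * (u a * _)]mulrCA -expr2.
  rewrite sg_sqr mulr1 addrAC subrr add0r !mulr_sumr; apply: eq_bigr => b _.
  by rewrite /w /sgn /=; ring.
have wE : \sum_(j <- js) w j ^+ 2 <= r%:R^-1.
  rewrite /js big_filter /= -(pair_big xpredT (fun b => b != a)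
    (fun k b => w (k, b) ^+ 2))/=.
  rewrite /w /= sumr_const card_ord.
  rewrite (@le_trans _ _ ((r%:R ^- 2) *+ r))//; last first.
    by rewrite -mulr_natr le_eqVlt; apply/orP; left; apply/eqP; field.
  rewrite lerMn2r; apply/orP; right.
  apply: le_trans (_ : r%:R ^- 2 * \sum_b u b ^+ 2 <= _); last first.
    by rewrite ler_piMr// invr_ge0 exprn_ge0.
  rewrite [X in _ <= _ * X](bigD1 a)//= mulrDr mulr_sumr; apply: ler_wpDl.
    by rewrite mulr_ge0 ?sqr_ge0// invr_ge0 exprn_ge0.
  by apply: ler_sum => b _; rewrite /w expr_div_n mulrC.
have w0 : 0 <= \sum_(j <- js) w j ^+ 2 by apply: sumr_ge0 => j _; exact: sqr_ge0.
have muw : (r%:R / 4) * \sum_(j <- js) w j ^+ 2 <= 4^-1.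
  apply: le_trans (_ : r%:R / 4 * r%:R^-1 <= _); first by rewrite ler_wpM2l.
  by rewrite mulrAC divff// mul1r.
under eq_bigr do rewrite errE.
(* For 0 <= z <= 1/4 one has z + 4 z^2 <= 1/2. *)
apply: (@le_trans _ _ (#|signs|%:R * expR (r%:R / 4 * (\sum_(j <- js) w j ^+ 2) +
   4 * (r%:R / 4 * \sum_(j <- js) w j ^+ 2) ^+ 2))); last first.
  rewrite ler_wpM2l// ler_expR.
  have : 0 <= r%:R / 4 * \sum_(j <- js) w j ^+ 2 by rewrite mulr_ge0.
  by move: muw; move: (_ * \sum_(j <- js) _) => z; nra.
have flipE (j : J) (s : signs) k b :
  flip j s k b = s k b (+) ((k, b) == j) by rewrite !ffunE.
apply: (@rademacher_sqr_mgf R _ _ sgn flip).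
- exact/filter_uniq/index_enum_uniq.
- move=> j _; apply: inv_inj => s; apply/ffunP => k; apply/ffunP => b.
  by rewrite !flipE -addbA addbb addbF.
- move=> [k b]; rewrite mem_filter /= => /andP[ba _] s.
  rewrite /sgn !flipE /= eqxx xpair_eqE eqxx/= eq_sym (negPf ba) addbF.
  by rewrite sg_addb /sg expr1 mulrN1 mulrN.
- move=> [k b] [k' b']; rewrite !mem_filter /= => /andP[ba _] /andP[ba' _] ne s.
  by rewrite /sgn !flipE/= (negPf ne) xpair_eqE [a == b']eq_sym (negPf ba') andbF !addbF.
- by move=> j _ s; rewrite /sgn exprMn !sg_sqr mulr1.
- by rewrite ger0_norm.
Qed.

(** Jensen with weights [x a ^+ 2] reduces to single coordinates, all with the same bound; the
    missing mass contributes at most its share since exp (1/2) >= 1. Hence the size of [A] does not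
    enter. *)
Lemma sketch_coord_err_weighted_mgf u (x : A -> R) : (0 < r)%N ->
  \sum_a u a ^+ 2 <= 1 -> \sum_a x a ^+ 2 <= 1 ->
  \sum_(s : signs)
    expR (r%:R / 4 * \sum_a x a ^+ 2 * sketch_coord_err s u a ^+ 2) <=
  #|signs|%:R * expR 2^-1.
Proof.
move=> r0 u1 x1.
have e1 : 1 <= expR (2^-1 : R) by rewrite -[leLHS]expR0 ler_expR.
have := fun s : signs => expR_jensen
  (fun a => r%:R / 4 * sketch_coord_err s u a ^+ 2) (fun a => sqr_ge0 (x a)) x1.
move=> /(fun h => ler_sum (index_enum signs) (P := xpredT) (fun s _ => h s)) h.
apply: le_trans (le_trans h _).
  rewrite le_eqVlt; apply/orP; left; apply/eqP; apply: eq_bigr => s _.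
  by rewrite mulr_sumr; congr expR; apply: eq_bigr => a _; rewrite mulrCA.
rewrite big_split/= sumr_const exchange_big /=.
apply: (@le_trans _ _ ((\sum_a x a ^+ 2) * (#|signs|%:R * expR 2^-1) +
   (1 - \sum_a x a ^+ 2) * #|signs|%:R)).
  rewrite mulr_natr lerD2r mulr_suml; apply: ler_sum => a _.
  by rewrite -mulr_sumr ler_wpM2l ?sqr_ge0// sketch_coord_err_mgf.
rewrite [leRHS](_ : _ = (\sum_a x a ^+ 2) * (#|signs|%:R * expR 2^-1) +
  (1 - \sum_a x a ^+ 2) * (#|signs|%:R * expR 2^-1)); last by ring.
by rewrite lerD2l ler_wpM2l ?subr_ge0// ler_peMr.
Qed.

End sketch.

(** * Existence of a good sketch by the probabilistic method *)

Lemma exists_lt_mean (R : realDomainType) (W : finType) (f : W -> R) (c : R) :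
  \sum_w f w < #|W|%:R * c -> exists w, f w < c.
Proof.
move=> lt_sum; apply: contrapT => /forallNP ge_c; move: lt_sum.
rewrite ltNge => /negP; apply.
rewrite mulr_natl -sumr_const; apply: ler_sum => w _.
by rewrite leNgt; apply/negP/ge_c.
Qed.

(** Every coordinate of [x] is at most 1 in absolute value, so the diagonal matrix of [x] is a
    contraction. *)
Lemma sum_sqr_mul_le (R : realDomainType) (A : finType) (x u : A -> R) :
  \sum_a x a ^+ 2 <= 1 -> \sum_a (x a * u a) ^+ 2 <= \sum_a u a ^+ 2.
Proof.
move=> x1; apply: ler_sum => a _; rewrite exprMn ler_piMl ?sqr_ge0//.
by apply: le_trans x1; rewrite (bigD1 a)//= lerDl sumr_ge0// => b _; exact: sqr_ge0.
Qed.

Section gram.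
Variables (R : realType) (A : finType) (r : nat).
Implicit Types (s : signs A r) (u y x : A -> R).

(* [gram s] is [u |-> P (P^T u)] for the matrix [P] with [r] columns and
   entries [sg (s k a) / sqrt r]. *)
Definition gram s u : A -> R :=
  fun a => r%:R^-1 * \sum_(k < r) sg R (s k a) * rad (s k) u.

Lemma gram_dot s u y :
  \sum_a gram s u a * y a = r%:R^-1 * \sum_(k < r) rad (s k) u * rad (s k) y.
Proof.
under eq_bigr do rewrite /gram -mulrA mulr_suml.
rewrite -mulr_sumr exchange_big /=; congr *%R; apply: eq_bigr => k _.
by rewrite [rad (s k) y]/rad mulr_sumr; apply: eq_bigr => a _; ring.
Qed.

Lemma radZ (t : {ffun A -> bool}) (c : R) u :
  rad t (fun a => c * u a) = c * rad t u.
Proof. by rewrite /rad mulr_sumr; apply: eq_bigr => a _; rewrite mulrA. Qed.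

Lemma gramZ s (c : R) u a : gram s (fun a => c * u a) a = c * gram s u a.
Proof.
rewrite /gram mulrCA; congr *%R; rewrite mulr_sumr; apply: eq_bigr => k _.
by rewrite radZ mulrCA.
Qed.

(** Write [gram s u] as [u] plus the coordinate error. Both parts, multiplied by [x], have squared
    norm at most 1, and (p + q)^2 <= 2 p^2 + 2 q^2. *)
Lemma gram_coord_sqr_le s u x : \sum_a u a ^+ 2 <= 1 -> \sum_a x a ^+ 2 <= 1 ->
  \sum_a x a ^+ 2 * sketch_coord_err s u a ^+ 2 <= 1 ->
  \sum_a (x a * gram s u a) ^+ 2 <= 4.
Proof.
move=> u1 x1 e1; have xu := le_trans (sum_sqr_mul_le u x1) u1.
have : \sum_a (x a * gram s u a) ^+ 2 <= \sum_a (2 * (x a * u a) ^+ 2 +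
    2 * (x a ^+ 2 * sketch_coord_err s u a ^+ 2)).
  apply: ler_sum => a _; rewrite -exprMn.
  have -> : x a * gram s u a = x a * u a + x a * sketch_coord_err s u a.
    by rewrite /sketch_coord_err -/(gram s u a); ring.
  have := sqr_ge0 (x a * u a - x a * sketch_coord_err s u a).
  by rewrite sqrrB sqrrD; lra.
by rewrite big_split/= -!mulr_sumr; lra.
Qed.

(** The union bound: both exponentials are at most 1 / (2 e N), so the total is at most (2 + sqrt e)
    / (2 e), which is below 1 because sqrt e >= 3/2. This is the origin of the factor 2e inside the
    logarithm. *)
Lemma sketch_potential_lt1 (N e : R) (q : nat) : 1 <= N -> 0 < e <= 1 ->
  ln (2 * expR 1 * N) <= q%:R * e ^+ 2 / 64 ->
  N * (2 * expR (- (q%:R * e ^+ 2 / 64)) + expR 2^-1 * expR (- (q%:R / 4))) < 1.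
Proof.
move=> N1 /andP[e0 e1] hln.
have e1_ge2 : 2 <= expR 1 :> R by have := expR_ge1Dx (1 : R); lra.
have half0 := expR_gt0 (2^-1 : R).
have half : expR 2^-1 * expR 2^-1 = expR 1 :> R by rewrite -expRD; congr expR; lra.
have half15 : 3 / 2 <= expR 2^-1 :> R by have := expR_ge1Dx (2^-1 : R); lra.
set D := 2 * expR 1 * N in hln *.
have D0 : 0 < D by rewrite mulr_gt0 ?mulr_gt0 ?expR_gt0//; lra.
have Dexp : expR (- ln D) = D^-1 by rewrite expRN lnK.
have h1 : expR (- (q%:R * e ^+ 2 / 64)) <= D^-1 by rewrite -Dexp ler_expR lerN2.
have h2 : expR (- (q%:R / 4)) <= D^-1.
  rewrite (le_trans _ h1)// ler_expR lerN2.
  have : q%:R * e ^+ 2 <= q%:R by rewrite ler_piMr// exprn_ile1// ltW.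
  have : 0 <= q%:R :> R by [].
  by lra.
apply: (@le_lt_trans _ _ (N * (2 * D^-1 + expR 2^-1 * D^-1))).
  by rewrite ler_wpM2l ?lerD ?ler_wpM2l//; lra.
have -> : N * (2 * D^-1 + expR 2^-1 * D^-1) = (2 + expR 2^-1) / (2 * expR 1).
  rewrite /D; have := expR_gt0 (1 : R) => ?.
  by field; rewrite !lt0r_neq0//; lra.
rewrite ltr_pdivrMr ?mulr_gt0 ?expR_gt0// mul1r -half.
by nra.
Qed.

Lemma exists_unit_sketch (I : finType) (u y x : I -> A -> R) (e : R) :
  (0 < r)%N -> (0 < #|I|)%N -> 0 < e <= 1 ->
  (forall i, \sum_a u i a ^+ 2 <= 1) -> (forall i, \sum_a y i a ^+ 2 <= 1) ->
  (forall i, \sum_a x i a ^+ 2 <= 1) ->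
  ln (2 * expR 1 * #|I|%:R) <= r%:R * e ^+ 2 / 64 ->
  exists s : signs A r, forall i,
    `|sketch_err s (u i) (y i)| <= e /\ \sum_a (x i a * gram s (u i) a) ^+ 2 <= 4.
Proof.
move=> r0 I0 e01 u1 y1 x1 hr; have /andP[e0 e1] := e01.
pose E s i := sketch_err s (u i) (y i).
pose Q s i := \sum_a x i a ^+ 2 * sketch_coord_err s (u i) a ^+ 2.
(* The minimizer of 16 l^2 - l e, with value - e^2 / 64; it satisfies l <= 1/8 because e <= 1. *)
pose l := e / 32.
have r0' : 0 < r%:R :> R by rewrite ltr0n.
have l0 : 0 < l by rewrite divr_gt0.
(* One exponential for each inequality wanted at [i], of value at least 1 when that inequality
   fails. A sketch whose total is below 1 therefore satisfies all of them. *)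
pose phi s i := expR (l * r%:R * (E s i - e)) + expR (l * r%:R * (- E s i - e)) +
  expR (r%:R / 4 * (Q s i - 1)).
have [s hs] : exists s, \sum_i phi s i < 1.
  apply: exists_lt_mean; rewrite exchange_big /=.
  apply: (@le_lt_trans _ _ (\sum_(i : I) #|signs A r|%:R *
    (2 * expR (- (r%:R * e ^+ 2 / 64)) + expR 2^-1 * expR (- (r%:R / 4))))).
    apply: ler_sum => i _; rewrite !big_split/=.
    have jl (b : bool) : \sum_s expR (l * r%:R * ((-1) ^+ b * E s i - e)) <=
        #|signs A r|%:R * expR (- (r%:R * e ^+ 2 / 64)).
      under eq_bigr do rewrite mulrBr expRD mulrA [l * _ * _]mulrAC.
      rewrite -mulr_suml.
      have := @sketch_err_mgf R A r (u i) (y i) (l * (-1) ^+ b) r0 (u1 i) (y1 i).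
      rewrite normrM normrX normrN1 expr1n mulr1 exprMn sqrr_sign mulr1.
      have -> : `|l| <= 8^-1 by rewrite gtr0_norm// /l; lra.
      move=> /(_ isT)/(ler_wpM2r (expR_ge0 (- (l * r%:R * e))))/le_trans; apply.
      rewrite -[leLHS]mulrA -expRD ler_wpM2l// ler_expR le_eqVlt; apply/orP; left.
      by apply/eqP; rewrite /l; field.
    have h0 := jl false; have h1 := jl true.
    rewrite (eq_bigr (fun s => expR (l * r%:R * (E s i - e)))) in h0; last first.
      by move=> s _; rewrite expr0 mul1r.
    rewrite (eq_bigr (fun s => expR (l * r%:R * (- E s i - e)))) in h1; last first.
      by move=> s _; rewrite expr1 mulN1r.
    have h2 : \sum_s expR (r%:R / 4 * (Q s i - 1)) <=
        #|signs A r|%:R * (expR 2^-1 * expR (- (r%:R / 4))).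
      under eq_bigr do rewrite mulrBr mulr1 expRD.
      rewrite -mulr_suml mulrA ler_wpM2r ?expR_ge0//.
      exact: sketch_coord_err_weighted_mgf.
    by move: h0 h1 h2; lra.
  rewrite sumr_const -mulrnAr ltr_pM2l.
    by rewrite -[ltLHS]mulr_natl; apply: sketch_potential_lt1; rewrite ?ler1n.
  rewrite ltr0n; apply/card_gt0P; by exists [ffun=> [ffun=> true]].
exists s => i.
have : phi s i < 1.
  apply: le_lt_trans hs; rewrite (bigD1 i)//= lerDl sumr_ge0// => j _.
  by rewrite /phi !addr_ge0 ?expR_ge0.
have lt0 (c z : R) : 0 < c -> expR (c * z) < 1 -> z < 0.
  by move=> c0; rewrite -[ltRHS]expR0 ltr_expR pmulr_rlt0.
rewrite /phi => hphi.
have h0 := expR_gt0 (l * r%:R * (E s i - e)).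
have h1 := expR_gt0 (l * r%:R * (- E s i - e)).
have h2 := expR_gt0 (r%:R / 4 * (Q s i - 1)).
have lr0 : 0 < l * r%:R by rewrite mulr_gt0.
have /(lt0 _ _ lr0) g0 : expR (l * r%:R * (E s i - e)) < 1 by lra.
have /(lt0 _ _ lr0) g1 : expR (l * r%:R * (- E s i - e)) < 1 by lra.
have /lt0 g2 : expR (r%:R / 4 * (Q s i - 1)) < 1 by lra.
have {}g2 : Q s i - 1 < 0 by apply: g2; rewrite divr_gt0.
split; first by rewrite ler_norml; apply/andP; split; rewrite -/(E s i); lra.
apply: gram_coord_sqr_le => //; rewrite -/(Q s i); lra.
Qed.

(** The unit case rescaled by [K]. The norm bound of the left vectors doubles, which is what
    produces the powers of 2 along the chain. *)
Lemma exists_sketch (I : finType) (u y x : I -> A -> R) (K e : R) :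
  (0 < r)%N -> (0 < #|I|)%N -> 0 < e <= 1 -> 0 < K ->
  (forall i, \sum_a u i a ^+ 2 <= K ^+ 2) -> (forall i, \sum_a y i a ^+ 2 <= 1) ->
  (forall i, \sum_a x i a ^+ 2 <= 1) ->
  ln (2 * expR 1 * #|I|%:R) <= r%:R * e ^+ 2 / 64 ->
  exists s : signs A r, forall i,
    `|\sum_a gram s (u i) a * y i a - \sum_a u i a * y i a| <= K * e /\
    \sum_a (x i a * gram s (u i) a) ^+ 2 <= (2 * K) ^+ 2.
Proof.
move=> r0 I0 e01 K0 uK y1 x1 hr.
have K0' : K != 0 by rewrite lt0r_neq0.
have u1 i : \sum_a (K^-1 * u i a) ^+ 2 <= 1.
  under eq_bigr do rewrite exprMn.
  by rewrite -mulr_sumr exprVn mulrC ler_pdivrMr ?exprn_gt0// mul1r.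
have [s hs] := exists_unit_sketch r0 I0 e01 u1 y1 x1 hr; exists s => i.
have [h1 h2] := hs i; split.
  have -> : \sum_a gram s (u i) a * y i a - \sum_a u i a * y i a =
      K * sketch_err s (fun a => K^-1 * u i a) (y i).
    rewrite /sketch_err -gram_dot mulrBr !mulr_sumr.
    congr (_ - _); apply: eq_bigr => a _; last by rewrite -mulrA mulVKf.
    by rewrite gramZ -mulrA mulVKf.
  by rewrite normrM gtr0_norm// ler_pM2l.
have -> : \sum_a (x i a * gram s (u i) a) ^+ 2 =
    K ^+ 2 * \sum_a (x i a * gram s (fun a => K^-1 * u i a) a) ^+ 2.
  by rewrite mulr_sumr; apply: eq_bigr => a _; rewrite gramZ -exprMn; congr (_ ^+ 2); rewrite [RHS]mulrCA mulVKf.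
by rewrite exprMn mulrC -natrX ler_pM2r ?exprn_gt0.
Qed.

End gram.

(** * Chains of sketches *)

Section chain.
Variables (R : realType) (A : finType) (r : nat).
Implicit Types (P : nat -> signs A r) (y : nat -> A -> R).

(** With S_j for [gram (P j)] and D_j for the diagonal matrix of [y j], this is D_k S_(k-1) D_(k-1)
    ... D_1 S_0 applied to [y 0]. *)
Fixpoint lvec P y k : A -> R :=
  if k is k'.+1 then fun a => y k a * gram (P k') (lvec P y k') a else y 0.

(** The complementary product S_k D_(k+1) S_(k+1) ... D_(k+l) applied to the all-ones vector. *)
Fixpoint rvec P y k l : A -> R :=
  if l is l'.+1 then gram (P k) (fun a => y k.+1 a * rvec P y k.+1 l' a)
  else fun=> 1.

Lemma gram_dotC (s : signs A r) (u v : A -> R) :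
  \sum_a gram s u a * v a = \sum_a u a * gram s v a.
Proof.
under [RHS]eq_bigr do rewrite mulrC.
by rewrite !gram_dot; congr *%R; apply: eq_bigr => k _; rewrite mulrC.
Qed.

Lemma lvec_rvec P y k l :
  \sum_a lvec P y (k + l) a = \sum_a lvec P y k a * rvec P y k l a.
Proof.
elim: l k => [|l IH] k; first by rewrite addn0; under [RHS]eq_bigr do rewrite mulr1.
rewrite addnS -addSn IH /= -gram_dotC; apply: eq_bigr => a _.
by rewrite mulrAC mulrC mulrA.
Qed.

Lemma eq_lvec P y y' k : (forall j, (j <= k)%N -> y j = y' j) ->
  lvec P y k = lvec P y' k.
Proof.
elim: k => [|k IH] e /=; first exact: e.
by rewrite e// IH// => j jk; rewrite e// (leq_trans jk).
Qed.

Lemma eq_rvec P y y' k l : (forall j, (k < j)%N -> y j = y' j) ->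
  rvec P y k l = rvec P y' k l.
Proof.
elim: l k => [|l IH] k e //=.
by rewrite e// (IH k.+1)// => j jk; rewrite e// (leq_trans _ jk).
Qed.

Lemma eq_lvec_signs P P' y k : (forall j, (j < k)%N -> P j = P' j) ->
  lvec P y k = lvec P' y k.
Proof.
elim: k => [//|k IH] e /=.
by rewrite e// IH// => j jk; rewrite e// (leq_trans jk).
Qed.

(** Cut the chain at the sketch [P k]: it has rank [r], and the sum over its [r] columns separates
    the factors up to [k] from those after [k]. *)
Lemma lvec_separated P y y' k l :
  \sum_a lvec P (fun j => if (j < k.+1)%N then y j else y' j) (k.+1 + l) a =
  \sum_(b < r) (r%:R^-1 * rad (P k b) (lvec P y k)) *
     rad (P k b) (fun a => y' k.+1 a * rvec P y' k.+1 l a).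
Proof.
rewrite addSnnS lvec_rvec /= ltnn -gram_dotC gram_dot mulr_sumr.
rewrite (@eq_lvec _ _ y) => [|j]; last by rewrite ltnS => ->.
rewrite (@eq_rvec _ _ y') => [|j jk]; last by rewrite ltnNge ltnW.
by apply: eq_bigr => b _; rewrite mulrA.
Qed.

Lemma sum_sqr_prod_nat_le1 y k n :
  (forall j, \sum_a y j a ^+ 2 <= 1) -> (k < n)%N ->
  \sum_a (\prod_(k <= j < n) y j a) ^+ 2 <= 1.
Proof.
move=> y1; elim: n => // n IH; rewrite ltnS leq_eqVlt => /predU1P[->|kn].
  by under eq_bigr do rewrite big_nat1.
under eq_bigr do rewrite big_nat_recr ?(ltnW kn)//= mulrC.
exact: le_trans (sum_sqr_mul_le _ (y1 n)) (IH kn).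
Qed.

(** A hybrid argument: the first [K] sketches are inserted while the remaining factors stay exact.
    The left vector has norm at most 2^K, so the next sketch costs 2^K e, and the costs add up to
    (2^K - 1) e. *)
Lemma chain_approx (I : finType) (Y : I -> nat -> A -> R) (e : R) (D K : nat) :
  (0 < r)%N -> (0 < #|I|)%N -> 0 < e <= 1 ->
  (forall i j, \sum_a Y i j a ^+ 2 <= 1) ->
  ln (2 * expR 1 * #|I|%:R) <= r%:R * e ^+ 2 / 64 -> (K <= D)%N ->
  exists P, forall i, \sum_a lvec P (Y i) K a ^+ 2 <= (2 ^+ K) ^+ 2 /\
    `|\sum_a lvec P (Y i) K a * (\prod_(K.+1 <= j < D.+1) Y i j a) -
      \sum_a \prod_(0 <= j < D.+1) Y i j a| <= (2 ^+ K - 1) * e.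
Proof.
move=> r0 I0 e01 Y1 hr; elim: K => [_|K IH KD].
  (* Arbitrary signs: [lvec] at 0 involves no sketch, and the error is 0. *)
  exists (fun=> [ffun=> [ffun=> true]]) => i; split => /=.
    by rewrite expr0 expr1n.
  under [X in _ - X]eq_bigr do rewrite big_ltn//.
  by rewrite subrr normr0 subrr mul0r.
have [P hP] := IH (ltnW KD).
have rest1 i : \sum_a (\prod_(K.+1 <= j < D.+1) Y i j a) ^+ 2 <= 1.
  exact: sum_sqr_prod_nat_le1.
have K0 : 0 < 2 ^+ K :> R by rewrite exprn_gt0.
have [s hs] := exists_sketch r0 I0 e01 K0 (fun i => (hP i).1) rest1
  (fun i => Y1 i K.+1) hr.
exists (fun j => if (j < K)%N then P j else s) => i.
have lE : lvec (fun j => if (j < K)%N then P j else s) (Y i) K = lvec P (Y i) K.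
  by apply: eq_lvec_signs => j ->.
rewrite [lvec _ _ K.+1]/= lE ltnn; have [h1 h2] := hs i; split; first by rewrite [2 ^+ K.+1]exprS.
have [_ h3] := hP i.
have -> : \sum_a Y i K.+1 a * gram s (lvec P (Y i) K) a *
      \prod_(K.+2 <= j < D.+1) Y i j a =
    \sum_a gram s (lvec P (Y i) K) a * \prod_(K.+1 <= j < D.+1) Y i j a.
  by apply: eq_bigr => a _; rewrite [in RHS]big_ltn// [RHS]mulrCA [RHS]mulrA.
rewrite (le_trans (ler_distD (\sum_a lvec P (Y i) K a *
  \prod_(K.+1 <= j < D.+1) Y i j a) _ _))// (le_trans (lerD h1 h3))//.
by rewrite exprS; lra.
Qed.

End chain.

(** * Low-rank unfoldings and approximation of one inner product *)

Section separation.
Variables (R : realType) (d : nat) (n : 'I_d -> nat).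
Local Notation index := {dffun forall j : 'I_d, 'I_(n j)}.

Definition splice (k : nat) (i i' : index) : index :=
  finfun (fun j : 'I_d => if (j < k)%N then i j else i' j).

(* The [k]-th unfolding matrix of [T] has rank at most [q]; the index [i] of
   its rows matters only through [i_0 .. i_(k-1)], that of its columns through
   [i_k .. i_(d-1)]. *)
Definition separated (k q : nat) (T : tensor R n) : Prop :=
  exists (a b : index -> 'I_q -> R),
    forall i i', T (splice k i i') = \sum_(t < q) a i t * b i' t.

Lemma separated_add k q q' T T' : separated k q T -> separated k q' T' ->
  separated k (q + q') (fun i => T i + T' i).
Proof.
move=> [a [b h]] [a' [b' h']].
pose glue (f : index -> 'I_q -> R) (g : index -> 'I_q' -> R) (i : index) (t : 'I_(q + q')) :=
  match fintype.split t with inl u => f i u | inr u => g i u end.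
exists (glue a a'), (glue b b') => i i'; rewrite h h' big_split_ord /glue /=.
congr (_ + _); apply: eq_bigr => t _.
  by rewrite (unsplitK (inl t)).
by rewrite (unsplitK (inr t)).
Qed.

Lemma separated_scale k q (c : R) T : separated k q T ->
  separated k q (fun i => c * T i).
Proof.
move=> [a [b h]]; exists (fun i t => c * a i t), b => i i'.
by rewrite h mulr_sumr; apply: eq_bigr => t _; rewrite mulrA.
Qed.

Lemma separated_const k (c : R) : separated k 1 (fun=> c).
Proof. by exists (fun _ _ => c), (fun _ _ => 1) => i i'; rewrite big_ord1 mulr1. Qed.

Lemma separated_sum k q m (T : nat -> tensor R n) :
  (forall s, separated k q (T s)) ->
  separated k (m * q) (fun i => \sum_(s < m) T s i).
Proof.
move=> h; elim: m => [|m IH].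
  exists (fun _ _ => 0), (fun _ _ => 0) => i i'.
  by rewrite big_ord0 big1// => t _; rewrite mulr0.
rewrite mulSn addnC; have [a [b e]] := separated_add IH (h m).
by exists a, b => i i'; rewrite big_ord_recr; exact: e.
Qed.

End separation.

Lemma card_tensor_index (d : nat) (n : 'I_d -> nat) :
  #|{dffun forall j : 'I_d, 'I_(n j)}| = (\prod_(j < d) n j)%N.
Proof.
rewrite card_dep_ffun foldrE big_image /=.
by apply: eq_bigr => j _; rewrite card_ord.
Qed.

Lemma hoinner_approx (R : realType) (A : finType) (D : nat) (n : 'I_D.+1 -> nat)
    (x : forall j, 'I_(n j) -> A -> R) (r : nat) (e : R) :
  (0 < r)%N -> (forall j, (0 < n j)%N) -> 0 < e <= 1 ->
  (forall j i, \sum_a x j i a ^+ 2 <= 1) ->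
  ln (2 * expR 1 * \prod_(j < D.+1) (n j)%:R) <= r%:R * e ^+ 2 / 64 ->
  exists T : tensor R n,
    (forall k, (0 < k < D.+1)%N -> separated k r T) /\
    forall i, `|T i - \sum_a \prod_(j < D.+1) x j (i j) a| <= 2 ^+ D * e.
Proof.
move=> r0 n0 e01 x1 hr.
pose index := {dffun forall j : 'I_D.+1, 'I_(n j)}.
(* Padding by the zero vector keeps the norm bound of [chain_approx] valid at every natural
   number. *)
pose Y (i : index) (j : nat) : A -> R :=
  if (j < D.+1)%N then x (inord j) (i (inord j)) else fun=> 0.
have hr' : ln (2 * expR 1 * #|index|%:R) <= r%:R * e ^+ 2 / 64.
  by rewrite card_tensor_index natr_prod.
have I0 : (0 < #|index|)%N by rewrite card_tensor_index prodn_gt0.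
have Y1 i j : \sum_a Y i j a ^+ 2 <= 1.
  rewrite /Y; case: ifP => // _.
  by rewrite big1// => a _; rewrite expr0n.
have [P hP] := chain_approx r0 I0 e01 Y1 hr' (leqnn D).
exists (fun i => \sum_a lvec P (Y i) D a); split.
  (* The unfolding at [k.+1] groups the factors 0 to [k] as rows, so the cut goes through the sketch
     [P k]. *)
  move=> [//|k] /= kD.
  exists (fun i b => r%:R^-1 * rad (P k b) (lvec P (Y i) k)).
  exists (fun i b => rad (P k b)
    (fun a => Y i k.+1 a * rvec P (Y i) k.+1 (D - k.+1) a)) => i i'.
  rewrite -lvec_separated subnKC//; apply: eq_bigr => a _.
  congr (lvec P _ D a); apply/funext => j; rewrite /Y.
  case: ltnP => jD; last by rewrite if_same.
  by rewrite /splice ffunE inordK//; case: ifP.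
move=> i; have [_ h] := hP i.
have -> : \sum_a \prod_(j < D.+1) x j (i j) a = \sum_a \prod_(0 <= j < D.+1) Y i j a.
  apply: eq_bigr => a _; rewrite big_mkord; apply: eq_bigr => j _.
  by rewrite /Y ltn_ord inord_val.
rewrite (eq_bigr (lvec P (Y i) D)) in h; last first.
  by move=> a _; rewrite big_geq// mulr1.
rewrite (le_trans h)// ler_wpM2r//; last by lra.
by case/andP: e01 => /ltW.
Qed.

(** * TT rank and unfoldings *)

Section dependent_update.
Variables (I : finType) (S : I -> finType).
Local Notation fam := {dffun forall k : I, S k}.

Definition dffun_upd (f : fam) (k : I) (v : S k) : fam := finfun (dfwith f k v).

Lemma dffun_upd_in f k v : @dffun_upd f k v k = v.
Proof. by rewrite ffunE dfwithin. Qed.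

Lemma dffun_upd_out f k v k' : k != k' -> @dffun_upd f k v k' = f k'.
Proof. by move=> ne; rewrite ffunE dfwithout. Qed.

End dependent_update.

Section TT_rank.
Variables (R : realType) (d : nat) (n : 'I_d -> nat).
Local Notation index := {dffun forall j : 'I_d, 'I_(n j)}.

Section chains.
Variable r : 'I_d.+1 -> nat.
Hypothesis r_gt0 : forall k, (0 < r k)%N.
Local Notation chain := {dffun forall k : 'I_d.+1, 'I_(r k)}.
Local Notation src := (widen_ord (leqnSn d)).
Local Notation tgt := (lift ord0).

Definition chain0 : chain := finfun (fun k => Ordinal (r_gt0 k)).

Lemma tgtE (j : 'I_d) : tgt j = j.+1 :> nat.
Proof. by rewrite lift0. Qed.

(** Fix the value [t] of the chain at [k]: the product of the cores then splits into links before
    and after [k]. Half-chains are encoded as full chains equal to [chain0] on the other side, so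
    that each is counted once. *)
Lemma TT_eval_separated (G : TT_cores R n r) (k : 'I_d.+1) :
  separated k (r k) (TT_eval G).
Proof.
pose lo (b c : chain) : chain :=
  finfun (fun l : 'I_d.+1 => if (l <= k)%N then b l else c l).
pose hi (c : chain) : chain :=
  finfun (fun l : 'I_d.+1 => if (k <= l)%N then c l else chain0 l).
pose Lf (i : index) (a : chain) :=
  \prod_(j < d | (j < k)%N) G j (a (src j)) (i j) (a (tgt j)).
pose Rf (i : index) (a : chain) :=
  \prod_(j < d | ~~ (j < k)%N) G j (a (src j)) (i j) (a (tgt j)).
exists (fun i t => \sum_(b : chain | (b k == t) && (lo b chain0 == b)) Lf i b).
exists (fun i t => \sum_(c : chain | (c k == t) && (hi c == c)) Rf i c) => i i'.
rewrite /TT_eval (partition_big (fun a : chain => a k) xpredT)//=.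
apply: eq_bigr => t _; rewrite big_distrlr pair_big /=.
rewrite (reindex_onto (fun p : chain * chain => lo p.1 p.2)
  (fun a => (lo a chain0, hi a))) /=; last first.
  move=> a _; apply/ffunP => l; rewrite !ffunE.
  by case: ltnP => // /ltnW ->.
apply: eq_big => [[b c]|[b c]] /=.
  have lok : lo b c k = b k by rewrite ffunE leqnn.
  have lolo : lo (lo b c) chain0 = lo b chain0.
    by apply/ffunP => l; rewrite !ffunE; case: (l <= k)%N.
  rewrite xpair_eqE lok lolo.
  apply/andP/andP => [[/eqP bt /andP[/eqP bb /eqP cc]]|[/andP[/eqP bt /eqP bb] /andP[/eqP ct /eqP cc]]].
    rewrite bt bb !eqxx /=; split=> //; apply/andP; split.
      by rewrite -cc /hi !ffunE !leqnn bt.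
    apply/eqP/ffunP => l; rewrite -{2}cc !ffunE; case: (leqP k l) => kl //.
    case: (leqP l k) => // lk; rewrite -{1}cc !ffunE kl lk.
    by [].
  rewrite bt bb !eqxx /=; split=> //.
  apply/eqP/ffunP => l; rewrite -{2}cc !ffunE; case: (leqP k l) => kl //.
  case: (leqP l k) => // lk.
  have -> : l = k by apply/val_inj/eqP; rewrite eqn_leq lk kl.
  by rewrite bt ct.
move=> /andP[/eqP bt]; rewrite xpair_eqE => /andP[_ /eqP cc].
have bc : b k = c k by rewrite -cc !ffunE !leqnn.
rewrite (bigID (fun j : 'I_d => (j < k)%N)) /=; congr (_ * _).
  apply: eq_bigr => j jk.
  by rewrite !ffunE tgtE /= jk (ltnW jk).
apply: eq_bigr => j; rewrite -leqNgt => kj.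
rewrite !ffunE tgtE /= [(j < k)%N]ltnNge kj /=.
congr (G j _ _ _); case: (leqP j k) => // jk.
have -> : src j = k by apply/val_inj/eqP; rewrite /= eqn_leq jk kj.
exact: bc.
Qed.

(** Encodes partial chains ending at [k]: beyond [k] they take the default value. *)
Definition chain_tail (k : 'I_d.+1) (a : chain) :=
  [forall l : 'I_d.+1, (k < l)%N ==> (a l == chain0 l)].

(** [B k] plays the role of the contraction of all cores from [k] on. Unrolling the recursion from
    the left expresses [T] through the first [k] cores and [B k], until [B] is 1. *)
Lemma TT_eval_of_recursion (G : TT_cores R n r) (T : tensor R n)
    (B : forall k, 'I_(r k) -> index -> R) :
  r ord0 = 1%N -> (forall t i, B ord0 t i = T i) -> (forall t i, B ord_max t i = 1) ->
  (forall (j : 'I_d) t i, B (src j) t i = \sum_u G j t (i j) u * B (tgt j) u i) ->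
  T =1 TT_eval G.
Proof.
move=> r0 B0 Bmax Bstep i.
pose X (a : chain) (j : 'I_d) := G j (a (src j)) (i j) (a (tgt j)).
suff H (m : nat) (k : 'I_d.+1) : k = m :> nat ->
    T i = \sum_(a : chain | chain_tail k a) (\prod_(j < d | (j < k)%N) X a j) * B k (a k) i.
  rewrite (H d ord_max erefl) /TT_eval; apply: eq_big => [a|a _].
    by apply/forallP => l; rewrite ltnNge -ltnS ltn_ord.
  by rewrite Bmax mulr1; apply: eq_bigl => j; rewrite ltn_ord.
elim: m k => [|m IH] k km.
  have -> : k = ord0 by exact: val_inj.
  rewrite (big_pred1 chain0) => [|a /=].
    by rewrite B0 big_pred0 ?mul1r.
  apply/forallP/eqP => [h|-> l]; last by rewrite eqxx implybT.
  apply/ffunP => l; have [->|l0] := eqVneq l ord0.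
    apply/val_inj; case: (a ord0) (chain0 ord0) => [x hx] [z hz] /=.
    by move: hx hz; rewrite r0 !ltnS !leqn0 => /eqP -> /eqP ->.
  by apply/eqP; apply: (implyP (h l)); rewrite lt0n.
have md : (m < d)%N by rewrite -ltnS -km ltn_ord.
pose j := Ordinal md.
have {k km} -> : k = tgt j by apply: ord_inj; rewrite tgtE km.
rewrite (IH (src j) erefl).
have ne : tgt j != src j by rewrite -val_eqE /= /bump /= add1n neq_ltn ltnSn orbT.
under eq_bigr do rewrite Bstep mulr_sumr.
rewrite pair_big_dep /=.
(* A partial chain ending one node later is a partial chain together with one new index. *)
symmetry; rewrite (reindex_onto
  (fun p : chain * 'I_(r (tgt j)) => dffun_upd p.1 p.2)
  (fun a => (dffun_upd a (chain0 (tgt j)), a (tgt j)))) /=; last first.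
  move=> a _; apply/ffunP => l; have [<-|nl] := eqVneq (tgt j) l.
    by rewrite dffun_upd_in.
  by rewrite !dffun_upd_out.
apply: eq_big => [[b u]|[b u]] /=.
  rewrite andbT xpair_eqE dffun_upd_in eqxx andbT.
  apply/andP/forallP => [[/forallP h /eqP e] l|h].
    apply/implyP => jl; have [<-|nl] := eqVneq (tgt j) l.
      by rewrite -e dffun_upd_in.
    have := h l; rewrite dffun_upd_out// => /implyP; apply.
    by rewrite tgtE ltn_neqAle jl andbT -tgtE val_eqE.
  split.
    apply/forallP => l; apply/implyP => jl.
    have nl : tgt j != l by rewrite -val_eqE neq_ltn jl.
    rewrite dffun_upd_out//; apply: (implyP (h l)).
    by apply: leq_ltn_trans jl; rewrite tgtE leqnSn.
  apply/eqP/ffunP => l; have [<-|nl] := eqVneq (tgt j) l.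
    rewrite dffun_upd_in; apply/esym/eqP/(implyP (h _)).
    by rewrite tgtE.
  by rewrite !dffun_upd_out.
move=> _; rewrite dffun_upd_in mulrA; congr (_ * _).
rewrite (bigD1 j) ?tgtE//= mulrC /bump leq0n add1n; congr (_ * _).
  apply: eq_big => [j'|j' /andP[jm nj]].
    by rewrite ltnS andbC -val_eqE -ltn_neqAle.
  rewrite ltnS in jm.
  have {nj jm}jm : (j' < m)%N by rewrite ltn_neqAle jm andbT.
  rewrite /X !dffun_upd_out//.
    apply/eqP => /(congr1 (@nat_of_ord _)); rewrite !tgtE => -[e].
    by move: jm; rewrite -e ltnn.
  apply/eqP => /(congr1 (@nat_of_ord _)); rewrite tgtE /= => e.
  by move: (ltnW jm); rewrite -e ltnn.
by rewrite /X dffun_upd_in dffun_upd_out.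
Qed.

End chains.

(** Both sides run over all multi-indices: the usual unfolding with rows and columns repeated, which
    leaves the rank unchanged. *)
Definition unfolding (T : tensor R n) (k : nat) : 'M[R]_#|{: index}| :=
  \matrix_(p, q) T (splice k (enum_val p) (enum_val q)).

Lemma sum_enum_val (f : index -> R) : \sum_i f i = \sum_(p < #|{: index}|) f (enum_val p).
Proof. by apply: reindex; exact/onW_bij/enum_val_bij. Qed.

Lemma mxrank_unfolding (T : tensor R n) k q :
  separated k q T -> (\rank (unfolding T k) <= q)%N.
Proof.
move=> [a [b h]].
have -> : unfolding T k = (\matrix_(p < #|{: index}|, t < q) a (enum_val p) t) *m
    \matrix_(t < q, p < #|{: index}|) b (enum_val p) t.
  by apply/matrixP => p p'; rewrite !mxE h; apply: eq_bigr => t _; rewrite !mxE.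
exact: mulmx_max_rank.
Qed.

(* The last clause puts the rows [b t] in the row space of the unfolding, so
   that they can be expanded over those of the next unfolding. *)
Lemma unfolding_factor (T : tensor R n) (k q : nat) :
  q = maxn 1 (\rank (unfolding T k)) ->
  exists x : (index -> 'I_q -> R) * ('I_q -> index -> R) * ('I_q -> index -> R),
    (forall i i', T (splice k i i') = \sum_t x.1.1 i t * x.1.2 t i') /\
    (forall t i', x.1.2 t i' = \sum_i x.2 t i * T (splice k i i')).
Proof.
set U := unfolding T k => qE.
have UE i i' : T (splice k i i') = U (enum_rank i) (enum_rank i').
  by rewrite mxE !enum_rankK.
(* A zero unfolding has rank 0 but [q = 1]; zero factors fill the single slot. *)
have [U0|U0] := eqVneq U 0.
  exists ((fun _ _ => 0, fun _ _ => 0), fun _ _ => 0); split=> [i i'|t i'] /=.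
    by rewrite UE U0 mxE big1// => t _; rewrite mul0r.
  by rewrite big1// => i _; rewrite mul0r.
have {}qE : q = \rank U by rewrite qE (maxn_idPr _)// lt0n mxrank_eq0.
move: q qE => _ ->.
pose C : 'M[R]_(\rank U, #|{: index}|) := row_base U *m pinvmx U.
have BE : C *m U = row_base U by rewrite mulmxKpV// eq_row_base.
exists ((fun i t => col_base U (enum_rank i) t, fun t i => row_base U t (enum_rank i)),
  fun t i => C t (enum_rank i)); split=> [i i'|t i'] /=.
  by rewrite UE -{1}(mulmx_base U) mxE.
rewrite -BE mxE sum_enum_val; apply: eq_bigr => p _.
by rewrite UE enum_valK.
Qed.

(** The minimal ranks are the unfolding ranks, raised to 1 where they vanish. They are lower bounds
    by [TT_eval_separated]; they are attained by expanding the row basis at each cut over the one at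
    the next cut. *)
Lemma is_rank_TT_exists (T : tensor R n) : (0 < d)%N -> (forall j, (0 < n j)%N) ->
  exists r : 'I_d.+1 -> nat, is_rank_TT T r /\
    forall (k : 'I_d.+1) q, (0 < k < d)%N -> (0 < q)%N -> separated k q T ->
      (r k <= q)%N.
Proof.
move=> d0 n0.
pose i0 : index := finfun (fun j => Ordinal (n0 j)).
pose rk (k : 'I_d.+1) : nat :=
  if (0 < k < d)%N then maxn 1 (\rank (unfolding T k)) else 1%N.
have rk0 k : (0 < rk k)%N by rewrite /rk; case: ifP => // _; rewrite leq_max.
have rk_min (k : 'I_d.+1) q : (0 < k < d)%N -> (0 < q)%N -> separated k q T ->
    (rk k <= q)%N.
  by move=> kd q0 sep; rewrite /rk kd geq_max q0 mxrank_unfolding.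
exists rk; split=> //; split; last first.
  move=> r' [r'0 r'd r'pos [G TG]] k.
  have [kd|kd] := boolP (0 < k < d)%N; last by rewrite /rk (negPf kd).
  apply: rk_min => //; have [a [b h]] := TT_eval_separated r'pos G k.
  by exists a, b => i i'; rewrite TG.
have rk_ord0 : rk ord0 = 1%N by [].
have rk_max : rk ord_max = 1%N by rewrite /rk ltnn andbF.
split=> //.
have fact (k : 'I_d.+1) : exists x : (index -> 'I_(rk k) -> R) *
    ('I_(rk k) -> index -> R) * ('I_(rk k) -> index -> R),
    [/\ forall i i', T (splice k i i') = \sum_t x.1.1 i t * x.1.2 t i',
    (k < d)%N -> forall t i', x.1.2 t i' = \sum_i x.2 t i * T (splice k i i'),
    k = ord0 -> forall t i, x.1.2 t i = T i &
    k = ord_max -> forall t i, x.1.2 t i = 1].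
  (* At the two ends trivial factorizations are chosen, to match the boundary conditions of
     [TT_eval_of_recursion]: [T] itself on the left, the constant 1 on the right. *)
  have [->|k0] := eqVneq k ord0.
    have spl (i i' : index) : splice (ord0 : 'I_d.+1) i i' = i' by apply/ffunP => j; rewrite ffunE.
    exists ((fun _ _ => 1, fun _ i => T i), fun _ i => (i == i0)%:R).
    split=> [i i'|_ t i'|//|e] /=.
    - by rewrite spl sumr_const card_ord rk_ord0 mul1r.
    - rewrite (bigD1 i0)//= eqxx mul1r spl big1 ?addr0// => i /negPf ->.
      by rewrite mul0r.
    - by case/eqP: (ltn_eqF d0); exact: (congr1 (@nat_of_ord _) e).
  have [->|kd] := eqVneq k ord_max.
    have spl (i i' : index) : splice (ord_max : 'I_d.+1) i i' = i.
      by apply/ffunP => j; rewrite ffunE /= ltn_ord.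
    exists ((fun i _ => T i, fun _ _ => 1), fun _ _ => 0).
    split=> [i i'| |e|//] /=.
    - by rewrite spl sumr_const card_ord rk_max mulr1.
    - by rewrite ltnn.
    - by case/eqP: (gtn_eqF d0); exact: (congr1 (@nat_of_ord _) e).
  have kd' : (0 < k < d)%N.
    rewrite lt0n -[0%N]/(nat_of_ord (@ord0 d)) val_eqE k0/=.
    by rewrite ltn_neqAle -ltnS ltn_ord andbT -[d]/(nat_of_ord (@ord_max d)) val_eqE.
  have [x [h1 h2]] : exists x : (index -> 'I_(rk k) -> R) *
      ('I_(rk k) -> index -> R) * ('I_(rk k) -> index -> R),
      (forall i i', T (splice k i i') = \sum_t x.1.1 i t * x.1.2 t i') /\
      (forall t i', x.1.2 t i' = \sum_i x.2 t i * T (splice k i i')).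
    by apply: unfolding_factor; rewrite /rk kd'.
  exists x; split=> // e; first by rewrite e eqxx in k0.
  by rewrite e eqxx in kd.
pose f k := projT1 (cid (fact k)).
have fP k := projT2 (cid (fact k)).
(* A basis row at cut j combines values of [T] with coefficients [(f _).2]. Moving the j-th entry to
   the row side turns these into values at cut j + 1, where they factor through the next basis. *)
pose G : TT_cores R n rk := fun j t p u =>
  \sum_i (f (widen_ord (leqnSn d) j)).2 t i *
          (f (lift ord0 j)).1.1 (dffun_upd i p) u.
exists G; apply: (TT_eval_of_recursion rk0 (B := fun k t i => (f k).1.2 t i)) => //.
- by move=> t i; have [_ _ h _] := fP ord0; exact: h.
- by move=> t i; have [_ _ _ h] := fP ord_max; exact: h.
move=> j t i.
have [_ h _ _] := fP (widen_ord (leqnSn d) j); rewrite h ?ltn_ord//= /G.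
under [RHS]eq_bigr do rewrite mulr_suml.
rewrite exchange_big /=; apply: eq_bigr => i' _.
have -> : splice j i' i = splice (lift ord0 j) (dffun_upd i' (i j)) i.
  apply/ffunP => l; rewrite [LHS]ffunE [RHS]ffunE tgtE ltnS.
  have [->|lj] := eqVneq l j; first by rewrite ltnn leqnn dffun_upd_in.
  by rewrite dffun_upd_out ?[j == l]eq_sym// ltn_neqAle (lj : l != j :> nat).
have [-> _ _ _] := fP (lift ord0 j).
by rewrite mulr_sumr; apply: eq_bigr => u _; rewrite mulrA.
Qed.

End TT_rank.

(** * Taylor expansion with one-sided derivatives *)

Section taylor.
Variable R : realType.
Implicit Types (D : set R) (f h : R -> R).

Lemma is_derive_monomial (k : R) m (x : R) :
  is_derive x 1 (fun t : R => k / m.+1`!%:R * t ^+ m.+1) (k * x ^+ m / m`!%:R).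
Proof.
rewrite (_ : (fun _ => _) = (k / m.+1`!%:R) \*: (id ^+ m.+1 : R -> R)); last first.
  by apply/funext => t; rewrite exprfctE.
apply: is_derive_eq; rewrite /GRing.scale /= factS natrM.
have h1 : m.+1%:R != 0 :> R by rewrite pnatr_eq0.
have h2 : m`!%:R != 0 :> R by rewrite pnatr_eq0 -lt0n fact_gt0.
by field; rewrite h2 nat1r h1.
Qed.

Lemma is_derive_exp_sum (c : nat -> R) n (x : R) :
  is_derive x 1 (fun t : R => \sum_(j < n.+1) c j * t ^+ j / j`!%:R)
    (\sum_(j < n) c j.+1 * x ^+ j / j`!%:R).
Proof.
elim: n => [|n IH].
  rewrite big_ord0 (_ : (fun _ => _) = cst (c 0%N)); first exact: is_derive_cst.
  by apply/funext => t; rewrite big_ord1 expr0 mulr1 fact0 divr1.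
rewrite (_ : (fun _ => _) = (fun t : R => \sum_(j < n.+1) c j * t ^+ j / j`!%:R) +
    (fun t => c n.+1 / n.+1`!%:R * t ^+ n.+1)); last first.
  by apply/funext => t; rewrite big_ord_recr /=; congr (_ + _); ring.
rewrite big_ord_recr /=; apply: is_deriveD.
exact: is_derive_monomial.
Qed.

(** Induction on [n]: the remainder of [g s.+1] is the derivative of that of [g s]. Derivatives are
    required only inside the interval and continuity at its ends, which accommodates one-sided
    derivatives. *)
Lemma taylor_chain (g : nat -> R -> R) (b : R) n s :
  (forall k, {within `[0, 1], continuous (g k)}) ->
  (forall k (t : R), t \in `]0, 1[ -> is_derive t 1 (g k) (g k.+1 t)) ->
  (forall t : R, t \in `[0, 1] -> `|g (s + n)%N t| <= b) ->
  forall t : R, t \in `[0, 1] ->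
    `|g s t - \sum_(j < n) g (s + j)%N 0 * t ^+ j / j`!%:R| <= b * t ^+ n / n`!%:R.
Proof.
move=> gc gd; elim: n s => [|n IH] s gb t t01.
  by rewrite big_ord0 subr0 expr0 mulr1 fact0 divr1 -[s]addn0 gb.
pose p x := \sum_(j < n.+1) g (s + j)%N 0 * x ^+ j / j`!%:R.
have p0 : p 0 = g s 0.
  rewrite /p big_ord_recl /= addn0 expr0 mulr1 fact0 divr1 big1 ?addr0// => j _.
  by rewrite expr0n /= mulr0 mul0r.
pose q (x : R) := b * x ^+ n.+1 / n.+1`!%:R.
have q0 : q 0 = 0 by rewrite /q expr0n /= mulr0 mul0r.
have dq (x : R) : is_derive x 1 q (b * x ^+ n / n`!%:R).
  rewrite (_ : q = fun x => b / n.+1`!%:R * x ^+ n.+1); last first.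
    by apply/funext => z; rewrite /q; ring.
  exact: is_derive_monomial.
have dp (x : R) : is_derive x 1 p (\sum_(j < n) g (s.+1 + j)%N 0 * x ^+ j / j`!%:R).
  under eq_bigr do rewrite addSnnS.
  exact: (@is_derive_exp_sum (fun j => g (s + j)%N 0)).
move: (t01); rewrite in_itv /= => /andP[t0 t1].
have sub (x : R) : x \in `]0, t[ -> x \in `]0, 1[.
  by rewrite !in_itv /= => /andP[-> /= xt]; exact: lt_le_trans xt t1.
have cont (f df : R -> R) : (forall x : R, is_derive x 1 f (df x)) ->
    {within `[0, t], continuous f}.
  move=> dff; apply: continuous_subspaceT => x; apply: differentiable_continuous.
  by apply/derivable1_diffP; case: (dff x).
have gct : {within `[0, t], continuous (g s)}.
  by apply: continuous_subspaceW (gc s) => x /=; rewrite !in_itv/= => /andP[-> /= /le_trans]; apply.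
have key (x : R) : x \in `]0, t[ ->
    `|g s.+1 x - \sum_(j < n) g (s.+1 + j)%N 0 * x ^+ j / j`!%:R| <= b * x ^+ n / n`!%:R.
  move=> /sub x01; apply: IH => [z z01|]; first by rewrite addSnnS gb.
  by move: x01; rewrite !in_itv /= => /andP[/ltW-> /ltW->].
pose dF (e x : R) := b * x ^+ n / n`!%:R +
  e * (g s.+1 x - \sum_(j < n) g (s.+1 + j)%N 0 * x ^+ j / j`!%:R).
(* For [e] equal to 1 or -1 this is nondecreasing and vanishes at 0; together the two signs bound
   the remainder by [q]. *)
pose F (e : R) := q + e \*: (g s - p).
have F_mono (e : R) : `|e| = 1 -> F e 0 <= F e t.
  move=> e1.
  have F_der (x : R) : x \in `]0, t[ -> is_derive x 1 (F e) (dF e x).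
    by move=> /sub x01; have dgx := gd s x x01; have dpx := dp x; have dqx := dq x;
      exact: is_deriveD.
  have F_cont : {within `[0, t], continuous (F e)}.
    move=> x; apply: continuousD; first exact: cont dq x.
    by apply: continuousZr; apply: continuousB; [exact: gct|exact: cont dp x].
  have dF_ge0 (x : R) : x \in `]0, t[ -> 0 <= dF e x.
    move=> /key; rewrite /dF -[X in X <= _]mul1r -e1 -normrM ler_norml => /andP[].
    by lra.
  exact: (MVT_nondecreasing t0 F_der F_cont dF_ge0).
have FE (e z : R) : F e z = q z + e * (g s z - p z) by [].
have := F_mono 1 (normr1 _); have := F_mono (-1) (normrN1 _).
rewrite !FE q0 p0 subrr !mulr0 addr0 mul1r mulN1r => hi lo.
by rewrite ler_norml -/(q t) -/(p t); apply/andP; split; lra.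
Qed.

Lemma cvg_within_dnbhs T (F : set_system T) {FF : Filter F} (phi : T -> R) D x :
  phi @ F --> x -> (\forall t \near F, D (phi t)) -> (\forall t \near F, phi t != x) ->
  phi @ F --> within D x^'.
Proof.
move=> cphi FD Fx S; rewrite /within/= => /cphi FS.
by apply: filterS3 FD Fx FS => t Dt xt; apply.
Qed.

Lemma derivable_within_cvg D f x : derivable_within D f x ->
  f y @[y --> within D x^'] --> f x.
Proof.
move=> dfx.
have fE : f = (fun y => diff_quot f x y * (y - x) + f x).
  apply/funext => y; rewrite /diff_quot; have [->|yx] := eqVneq y x.
    by rewrite !subrr mulr0 add0r.
  by rewrite divfK ?subr_eq0// subrK.
rewrite {1}fE -[f x in X in _ --> X]add0r -(mulr0 (derive_within D f x)).
apply: cvgD; last exact: cvg_cst.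
apply: cvgM; first exact: dfx.
rewrite -(subrr x); apply: cvgB; last exact: cvg_cst.
apply: cvg_trans (@cvg_id _ (nbhs x)).
by apply: cvg_trans (cvg_within _) (cvg_within _).
Qed.

Lemma derivable_within_is_derive D f x : nbhs x D -> derivable_within D f x ->
  is_derive x 1 f (derive_within D f x).
Proof.
move=> Dx dfx.
have phi : (fun t : R => t + x) @ 0^' --> x.
  rewrite -[X in _ --> X]add0r; apply: cvgD; last exact: cvg_cst.
  exact: cvg_within.
have dq : diff_quot f x (t + x) @[t --> 0^'] --> derive_within D f x.
  apply: (cvg_comp (fun t : R => t + x) (diff_quot f x) _ dfx); apply: cvg_within_dnbhs; [exact: phi|exact: phi|].
  by near=> t; rewrite -subr_eq0 addrK; near: t; exact: nbhs_dnbhs_neq.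
have cv : (fun t => t^-1 *: ((f \o shift x) (t *: 1) - f x)) @ 0^' -->
    derive_within D f x.
  rewrite (_ : (fun _ => _) = (fun t => diff_quot f x (t + x)))//.
  by apply/funext => t; rewrite /diff_quot addrK /= /GRing.scale /= mulr1 mulrC.
by apply: DeriveDef; [exact: cvgP cv|exact: cvg_lim cv].
Unshelve. all: by end_near. Qed.

(** Restrict [h] to the segment from 0 to [y]. For t < 1 the point [t * y] is interior to [D], so
    derivatives within [D] are ordinary there; [y] itself may be an endpoint, where only one-sided
    continuity is used. *)
Lemma taylor_within D h (c M a y : R) n :
  `[- a, a]%classic `<=` D -> smooth_within D h ->
  (forall s x, D x -> `|derive_within_n D s h x| <= c * M ^+ s) ->
  `|y| <= a -> (0 < n)%N ->
  `|h y - \sum_(j < n) derive_within_n D j h 0 * y ^+ j / j`!%:R| <=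
    c * (M * `|y|) ^+ n / n`!%:R.
Proof.
move=> aD sm bd ya; case: n => // n _.
pose f s := derive_within_n D s h.
(* Treated apart because the limit at t = 1 below needs [t * y] to differ from [y] for t < 1. *)
have [->|y0] := eqVneq y 0.
  rewrite big_ord_recl /= expr0 mulr1 fact0 divr1 big1 => [|j _]; last first.
    by rewrite expr0n /= mulr0 mul0r.
  by rewrite addr0 subrr normr0 mulr0 expr0n /= mulr0 mul0r.
have yp : 0 < `|y| by rewrite normr_gt0.
have inD (t : R) : `|t| <= 1 -> D (t * y).
  move=> t1; apply: aD; rewrite /= in_itv /= -ler_norml normrM.
  by apply: le_trans ya; rewrite ler_piMl.
have nbD (t : R) : `|t| < 1 -> nbhs (t * y) D.
  move=> t1; have : `](- a), a[%classic `<=` D.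
    by move=> z /= /[!in_itv]/= /andP[/ltW z1 /ltW z2]; apply: aD; rewrite /= in_itv /= z1.
  move=> /filterS; apply; apply: near_in_itvoo.
  rewrite in_itv /= -ltr_norml normrM; apply: lt_le_trans ya.
  by rewrite gtr_pMl.
pose g s (t : R) := y ^+ s * f s (t * y).
have dg s (t : R) : `|t| < 1 -> is_derive t 1 (g s) (g s.+1 t).
  move=> t1; have df : is_derive (t * y) 1 (f s) (f s.+1 (t * y)).
    by apply: derivable_within_is_derive; [exact: nbD|apply: sm; apply: inD; exact: ltW].
  have dl : is_derive t 1 (fun t : R => t * y) y.
    by apply: is_derive_eq; rewrite /GRing.scale /=; ring.
  have dc : is_derive t 1 (f s \o (fun t : R => t * y)) (f s.+1 (t * y) * y).
    exact: is_derive1_comp.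
  have -> : g s = (y ^+ s) \*: (f s \o (fun t : R => t * y)) by [].
  by apply: is_derive_eq; rewrite /g exprS /GRing.scale /=; ring.
have cg s : {within `[0, 1], continuous (g s)}.
  have cint (t : R) : `|t| < 1 -> g s @ t --> g s t.
    move=> t1; apply: differentiable_continuous; apply/derivable1_diffP.
    by case: (dg s t t1).
  apply/continuous_within_itvP => //; split.
  - move=> t; rewrite in_itv /= => /andP[t0 t1]; apply: cint.
    by rewrite gtr0_norm.
  - by apply: cvg_at_right_filter; apply: cint; rewrite normr0.
  - apply: cvgM; first exact: cvg_cst.
    rewrite mul1r; apply: (cvg_comp (fun t : R => t * y) (f s) _ (derivable_within_cvg (sm s y _))); last first.
      by rewrite -[y]mul1r; apply: inD; rewrite normr1.
    have in1 : \forall t \near (1 : R)^'-, D (t * y).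
      near=> t; apply: inD; rewrite ger0_norm; first by near: t; exact: nbhs_left_le.
      by apply: ltW; near: t; exact: nbhs_left_gt.
    have ne1 : \forall t \near (1 : R)^'-, t * y != y.
      near=> t; apply/eqP => e.
      have : t < 1 by near: t; exact: nbhs_left_lt.
      by rewrite (mulIf y0 (_ : t * y = 1 * y)) ?ltxx// mul1r.
    apply: (cvg_within_dnbhs _ in1 ne1).
    rewrite -[X in _ --> X]mul1r; apply: cvgM; last exact: cvg_cst.
    exact: cvg_within.
have gd k (t : R) : t \in `]0, 1[ -> is_derive t 1 (g k) (g k.+1 t).
  by rewrite in_itv /= => /andP[t0 t1]; apply: dg; rewrite gtr0_norm.
have gb (t : R) : t \in `[0, 1] -> `|g (0 + n.+1)%N t| <= c * (M * `|y|) ^+ n.+1.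
  rewrite in_itv /= add0n => /andP[t0 t1].
  rewrite /g normrM normrX exprMn [leRHS]mulrA [leLHS]mulrC ler_wpM2r ?exprn_ge0//.
  by apply: bd; apply: inD; rewrite ger0_norm.
have one01 : (1 : R) \in `[0, 1] by rewrite in_itv /= ler01 lexx.
have := @taylor_chain g _ n.+1 0 cg gd gb 1 one01.
rewrite expr1n mulr1 /g expr0 !mul1r; apply: le_trans.
rewrite le_eqVlt; apply/orP; left; apply/eqP; congr (`|_ - _|).
by apply: eq_bigr => j _; rewrite mul0r expr1n mulr1 [y ^+ _ * _]mulrC.
Unshelve. all: by end_near. Qed.

End taylor.

(** * Exponential series, tensor powers and assembly *)

Lemma exp_sum_le (R : realType) (z : R) n : 0 <= z ->
  \sum_(j < n) z ^+ j / j`!%:R <= expR z.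
Proof.
move=> z0; rewrite -(big_mkord xpredT (fun j => z ^+ j / j`!%:R)).
apply: (@nondecreasing_cvgn_le _ (series (exp_coeff z))).
  by apply: nondecreasing_series => j _ _; exact: exp_coeff_ge0.
exact: is_cvg_series_exp_coeff.
Qed.

Lemma exp_sum_tail_le (R : realType) (z : R) n : 0 <= z ->
  \sum_(j < n) z ^+ j.+1 / j.+1`!%:R <= expR z - 1.
Proof.
move=> /(exp_sum_le n.+1); rewrite big_ord_recl /= expr0 fact0 divr1.
by move=> h; rewrite lerBrDl.
Qed.

(** From n^n / n! <= e^n, a single term of the exponential series, (e^2 z)^n / n! <= e^n. This is
    where the lower bound on the Taylor order enters. *)
Lemma pow_div_fact_le (R : realType) (z : R) n :
  0 <= z -> expR 1 ^+ 2 * z <= n%:R -> z ^+ n / n`!%:R <= expR (- n%:R).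
Proof.
move=> z0 zn.
have e0 : 0 < expR 1 ^+ 2 :> R by rewrite exprn_gt0 ?expR_gt0.
have : (expR 1 ^+ 2 * z) ^+ n / n`!%:R <= expR n%:R.
  apply: (@le_trans _ _ (n%:R ^+ n / n`!%:R)).
    by rewrite ler_wpM2r// lerXn2r// nnegrE ?ler0n ?(pmulr_rge0 _ e0).
  apply: le_trans (exp_sum_le n.+1 (ler0n _ _)).
  by rewrite big_ord_recr /= lerDr sumr_ge0// => j _; rewrite divr_ge0// exprn_ge0.
have -> : expR n%:R = expR (- n%:R) * (expR 1 ^+ 2) ^+ n :> R.
  rewrite -!expRM_natl -expRD; congr expR; rewrite mulr1; ring.
by rewrite exprMn -mulrA mulrC ler_pM2r// exprn_gt0.
Qed.

Section powers.
Variables (R : realType) (D m : nat) (n : 'I_D.+1 -> nat) (rho : R).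
Variable x : forall j : 'I_D.+1, 'I_(n j) -> 'rV[R]_m.
Hypotheses (rho_gt0 : 0 < rho) (x_ball : forall j (i : 'I_(n j)), closed_eball rho (x i)).

Lemma scaled_sum_sqr_le1 j (i : 'I_(n j)) : \sum_(a < m) (x i ord0 a / rho) ^+ 2 <= 1.
Proof.
under eq_bigr do rewrite expr_div_n.
rewrite -mulr_suml ler_pdivrMr ?exprn_gt0// mul1r.
have s0 : 0 <= \sum_(a < m) x i ord0 a ^+ 2 by apply: sumr_ge0 => a _; exact: sqr_ge0.
rewrite -(sqr_sqrtr s0) lerXn2r ?nnegrE ?sqrtr_ge0 ?(ltW rho_gt0)//.
exact: (x_ball i).
Qed.

Lemma hoinner_scale (y : 'I_D.+1 -> 'rV[R]_m) :
  hoinner y = rho ^+ D.+1 * \sum_(a < m) \prod_(j < D.+1) (y j ord0 a / rho).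
Proof.
rewrite mulr_sumr; apply: eq_bigr => a _.
rewrite big_split/= prodr_const card_ord exprVn mulrCA divff ?mulr1//.
by rewrite expf_neq0// gt_eqF.
Qed.

(** After scaling, the first vector and the product of the others both have norm at most 1;
    expanding the squares of their sum and difference bounds their inner product. *)
Lemma hoinner_norm_le (i : {dffun forall j : 'I_D.+1, 'I_(n j)}) : (0 < D)%N ->
  `|hoinner (fun j => x (i j))| <= rho ^+ D.+1.
Proof.
move=> D0; rewrite hoinner_scale normrM ger0_norm; last by rewrite exprn_ge0// ltW.
rewrite ler_piMr ?exprn_ge0 ?(ltW rho_gt0)//.
pose y (j : nat) (a : 'I_m) := x (i (inord j)) ord0 a / rho.
have y1 j : \sum_a y j a ^+ 2 <= 1 by exact: scaled_sum_sqr_le1.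
have -> : \sum_(a < m) \prod_(j < D.+1) (x (i j) ord0 a / rho) =
    \sum_a y 0%N a * \prod_(1 <= j < D.+1) y j a.
  apply: eq_bigr => a _; rewrite -big_ltn// big_mkord.
  by apply: eq_bigr => j _; rewrite /y inord_val.
have hp := sum_sqr_prod_nat_le1 y1 (D0 : (1 < D.+1)%N).
have h0 := y1 0%N.
rewrite ler_norml; apply/andP; split.
  have : 0 <= \sum_a (y 0%N a + \prod_(1 <= j < D.+1) y j a) ^+ 2.
    by apply: sumr_ge0 => a _; exact: sqr_ge0.
  by rewrite sum_sqrD; lra.
have : 0 <= \sum_a (y 0%N a - \prod_(1 <= j < D.+1) y j a) ^+ 2.
  by apply: sumr_ge0 => a _; exact: sqr_ge0.
by rewrite sum_sqrB; lra.
Qed.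

(* The s-th power of a higher-order inner product is the higher-order inner
   product of the s-th tensor powers of the vectors. *)
Lemma hoinner_pow_approx (r : nat) (eps : R) (s : nat) :
  (0 < r)%N -> (forall j, (0 < n j)%N) -> 0 < eps <= 1 ->
  ln (2 * expR 1 * \prod_(j < D.+1) (n j)%:R) <= r%:R * (eps / 2 ^+ D) ^+ 2 / 64 ->
  exists T : tensor R n,
    (forall k, (0 < k < D.+1)%N -> separated k r T) /\
    forall i, `|T i - hoinner (fun j => x (i j)) ^+ s| <= eps * (rho ^+ D.+1) ^+ s.
Proof.
move=> r0 n0 /andP[e0 e1] hr.
(* The s-th tensor power of the scaled vector, with coordinates indexed by maps from ['I_s] to
   ['I_m]. The dimension m^s is harmless because [r] is independent of it. *)
pose z (j : 'I_D.+1) (i : 'I_(n j)) (f : {ffun 'I_s -> 'I_m}) : R :=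
  \prod_(k < s) (x i ord0 (f k) / rho).
have z1 j i : \sum_f z j i f ^+ 2 <= 1.
  under eq_bigr do rewrite /z -prodrXl.
  rewrite -(bigA_distr_bigA (fun _ a => (x i ord0 a / rho) ^+ 2)).
  rewrite prodr_const exprn_ile1 ?scaled_sum_sqr_le1//.
  by apply: sumr_ge0 => a _; exact: sqr_ge0.
have p0 : 0 < 2 ^+ D :> R by rewrite exprn_gt0.
(* This accuracy compensates the factor 2^D lost in [hoinner_approx]. *)
have e01 : 0 < eps / 2 ^+ D <= 1.
  rewrite divr_gt0//= ler_pdivrMr// mul1r (le_trans e1)// exprn_ege1//.
  by rewrite ler1n.
have [T [Tsep Terr]] := hoinner_approx r0 n0 e01 z1 hr.
exists (fun i => (rho ^+ D.+1) ^+ s * T i); split.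
  by move=> k /Tsep; exact: separated_scale.
move=> i; rewrite hoinner_scale exprMn -mulrBr normrM.
have q0 : 0 <= (rho ^+ D.+1) ^+ s by rewrite !exprn_ge0// ltW.
rewrite ger0_norm// mulrC ler_wpM2r//.
have := Terr i; rewrite mulrCA divff ?gt_eqF// mulr1.
suff -> : \sum_f \prod_(j < D.+1) z j (i j) f =
  (\sum_(a < m) \prod_(j < D.+1) (x (i j) ord0 a / rho)) ^+ s by [].
under eq_bigr do rewrite /z exchange_big /=.
rewrite -(bigA_distr_bigA (fun _ a => \prod_(j < D.+1) (x (i j) ord0 a / rho))).
by rewrite prodr_const card_ord.
Qed.

End powers.

Lemma Linfty_norm_le (R : realType) (D : set R) (f : R -> R) (b : R) :
  (Linfty_norm D f <= b%:E)%E -> forall x, D x -> `|f x| <= b.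
Proof.
move=> h x Dx; rewrite -lee_fin; apply: le_trans h.
by apply: ereal_sup_ubound; exists x.
Qed.

Section assembly.
Variables (R : realType) (D m : nat) (n : 'I_D.+1 -> nat) (rho eps : R).
Variable x : forall j : 'I_D.+1, 'I_(n j) -> 'rV[R]_m.

(** The constant term is exact and costs rank 1, and each of the [t] higher powers costs [r]; here
    [t] is the degree, one less than the number of Taylor terms. The errors sum to [eps] times the
    exponential series without its constant term. *)
Lemma series_approx (r t : nat) (C M : R) (c : nat -> R) :
  (0 < r)%N -> (forall j, (0 < n j)%N) -> 0 < eps <= 1 -> 0 < rho ->
  (forall j (i : 'I_(n j)), closed_eball rho (x i)) ->
  ln (2 * expR 1 * \prod_(j < D.+1) (n j)%:R) <= r%:R * (eps / 2 ^+ D) ^+ 2 / 64 ->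
  0 <= C -> 0 <= M -> (forall s, `|c s| <= C * M ^+ s) ->
  exists G : tensor R n,
    (forall k, (0 < k < D.+1)%N -> separated k (1 + t * r) G) /\
    forall i : {dffun forall j : 'I_D.+1, 'I_(n j)},
      `|\sum_(s < t.+1) c s * hoinner (fun j => x (i j)) ^+ s / s`!%:R - G i| <=
      C * (eps * (expR (M * rho ^+ D.+1) - 1)).
Proof.
move=> r0 n0 e01 rho0 xb hr C0 M0 cM.
pose T s := projT1 (cid (hoinner_pow_approx rho0 xb s.+1 r0 n0 e01 hr)).
have TP s := projT2 (cid (hoinner_pow_approx rho0 xb s.+1 r0 n0 e01 hr)).
pose a s := c s.+1 / s.+1`!%:R.
exists (fun i => c 0%N + \sum_(s < t) a s * T s i); split.
  move=> k kD; apply: separated_add; first exact: separated_const.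
  apply: (@separated_sum _ _ _ _ _ _ (fun s i => a s * T s i)) => s.
  by apply: separated_scale; have [h _] := TP s; exact: h.
move=> i; set y := hoinner _.
rewrite big_ord_recl /= expr0 mulr1 fact0 divr1 opprD addrACA subrr add0r -sumrB.
apply: (le_trans (ler_norm_sum _ _ _)).
have z0 : 0 <= M * rho ^+ D.+1 by rewrite mulr_ge0// exprn_ge0// ltW.
have eps0 : 0 <= eps by case/andP: (e01) => /ltW.
rewrite mulrA; apply: le_trans (ler_wpM2l (mulr_ge0 C0 eps0) (exp_sum_tail_le t z0)).
rewrite mulr_sumr; apply: ler_sum => s _.
have -> : c (bump 0 s) * y ^+ bump 0 s / (bump 0 s)`!%:R - a s * T s i =
    - (c s.+1 * (T s i - y ^+ s.+1)) / s.+1`!%:R.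
  by rewrite /a /bump add1n; ring.
rewrite mulNr normrN normrM normfV normrM [`|_%:R|]ger0_norm// mulrA ler_wpM2r ?invr_ge0//.
have [_ h] := TP s.
apply: le_trans (ler_pM (normr_ge0 _) (normr_ge0 _) (cM _) (h i)) _.
by rewrite exprMn le_eqVlt; apply/orP; left; apply/eqP; ring.
Qed.

End assembly.

Theorem theorem6p5 (R : realType) (d : nat) (hd : (3 <= d)%N) :
  exists c : R, 0 < c /\
  forall (eps : R) (n : 'I_d -> nat),
    0 < eps < 1 -> (forall j, (0 < n j)%N) ->
  let r : int :=
    Num.ceil (c / eps ^+ 2 * ln (2 * expR 1 * (\prod_(j < d) (n j)%:R))) in
  forall (rho : R) (Omega : set R) (h : R -> R) (C M : R),
    0 < rho ->
    is_interval Omega ->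
    `[- rho ^+ d, rho ^+ d]%classic `<=` Omega ->
    [bounded h x | x in Omega] ->
    smooth_within Omega h ->
    0 <= C -> 0 < M ->
    (forall s : nat,
      (Linfty_norm Omega (derive_within_n Omega s h) <= (C * M ^+ s)%:E)%E) ->
  forall (m : nat) (x : forall j : 'I_d, 'I_(n j) -> 'rV[R]_m) (F : tensor R n)
      (t : int),
    (0 < m)%N ->
    (forall j i, closed_eball rho (x j i)) ->
    (forall i, F i = h (hoinner (fun j => x j (i j)))) ->
    expR 1 ^+ 2 * M * rho ^+ d <= t%:~R ->
  exists (G : tensor R n) (rk : 'I_d.+1 -> nat),
    [/\ is_rank_TT G rk,
        forall k : 'I_d.+1, (0 < k < d)%N -> (rk k)%:Z <= 1 + (t - 1) * r
      & max_norm (fun i => F i - G i)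
          <= C * (expR (- t%:~R) + eps * (expR (M * rho ^+ d) - 1))].
Proof.
case: d hd => // D hD; have p0 : 0 < 2 ^+ D :> R by rewrite exprn_gt0.
have D0 : (0 < D)%N by rewrite -ltnS; apply: leq_trans hD.
(* The 64 comes from the moment bound of one sketch, the square from its accuracy [eps / 2 ^+ D]. *)
exists (64 * (2 ^+ D) ^+ 2); split; first by rewrite mulr_gt0 ?exprn_gt0.
move=> eps n /andP[e0 e1] n0 r rho Omega h C M rho0 _ sub _ sm C0 M0 bd.
move=> m x F t _ xb FE ht.
set N := 2 * expR 1 * _ in r *.
have N1 : 1 < N.
  have prod1 : 1 <= \prod_(j < D.+1) (n j)%:R :> R.
    by rewrite -natr_prod ler1n prodn_gt0.
  apply: (@lt_le_trans _ _ (2 * expR 1)).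
    by have := expR_ge1Dx (1 : R); lra.
  by rewrite ler_peMr// mulr_ge0 ?expR_ge0.
have lnN : 0 < ln N by rewrite ln_gt0.
have val0 : 0 < 64 * (2 ^+ D) ^+ 2 / eps ^+ 2 * ln N.
  by rewrite mulr_gt0// divr_gt0 ?mulr_gt0 ?exprn_gt0.
have r_ge : 64 * (2 ^+ D) ^+ 2 / eps ^+ 2 * ln N <= r%:~R by exact: ceil_ge.
have r_gt0 : 0 < r by rewrite -(ltr0z R); exact: lt_le_trans r_ge.
have : exists q : nat, r = q%:Z by exists `|r|%N; rewrite gez0_abs// ltW.
move=> [q rq]; rewrite {}rq in r_ge r_gt0 *.
have z0 : 0 < M * rho ^+ D.+1 by rewrite mulr_gt0 ?exprn_gt0.
have t_gt0 : 0 < t.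
  rewrite -(ltr0z R); apply: lt_le_trans ht.
  by rewrite -mulrA mulr_gt0 ?exprn_gt0 ?expR_gt0.
(* Since [t] is positive, [u] is the t - 1 of the rank bound and the top degree of the Taylor
   polynomial. *)
have : exists u : nat, t = u.+1%:Z.
  by exists `|t|.-1%N; rewrite prednK ?absz_gt0 ?gt_eqF// gez0_abs// ltW.
move=> [u tu]; rewrite {}tu in ht t_gt0 *.
have hr : ln N <= q%:R * (eps / 2 ^+ D) ^+ 2 / 64.
  have k0 : 0 < (eps / 2 ^+ D) ^+ 2 / 64 by rewrite divr_gt0 ?exprn_gt0 ?divr_gt0.
  rewrite -mulrA -ler_pdivrMr//; apply: le_trans r_ge.
  rewrite le_eqVlt; apply/orP; left; apply/eqP; field.
  by rewrite !gt_eqF.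
have in0 (y : R) : `|y| <= rho ^+ D.+1 -> Omega y.
  by rewrite ler_norml => yb; apply: sub; rewrite /= in_itv.
have bd' s y : Omega y -> `|derive_within_n Omega s h y| <= C * M ^+ s.
  exact: Linfty_norm_le.
have O0 : Omega 0 by apply: in0; rewrite normr0 exprn_ge0// ltW.
have e01 : 0 < eps <= 1 by rewrite e0 ltW.
have [G [Gsep Gerr]] := series_approx u r_gt0 n0 e01 rho0 xb hr C0 (ltW M0)
  (fun s => bd' s 0 O0).
have [rk [rkG rk_min]] := is_rank_TT_exists G (ltn0Sn D) n0.
exists G, rk; split=> //.
  move=> k kD; have := rk_min k _ kD (ltn0Sn (u * q)) (Gsep k kD).
  by rewrite -lez_nat (intS (u * q)) (intS u) PoszM (addrC 1 u%:Z) addrK.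
(* The maximum starts from the default 0, so the bound must also be shown nonnegative. *)
apply: bigmax_le => [|i _].
  rewrite mulr_ge0// addr_ge0 ?expR_ge0// mulr_ge0 ?(ltW e0)// subr_ge0.
  by rewrite -[leLHS]expR0 ler_expR ltW.
rewrite FE; set y := hoinner _.
have yb : `|y| <= rho ^+ D.+1 by exact: hoinner_norm_le.
rewrite mulrDr (le_trans (ler_distD
  (\sum_(s < u.+1) derive_within_n Omega s h 0 * y ^+ s / s`!%:R) _ _))// lerD//; last exact: Gerr.
have := taylor_within sub sm bd' yb (ltn0Sn u) => /le_trans; apply.
rewrite -mulrA ler_wpM2l//.
have Mz : M * `|y| <= M * rho ^+ D.+1 by rewrite ler_pM2l.
apply: pow_div_fact_le; first by rewrite mulr_ge0// ltW.
by apply: le_trans ht; rewrite -mulrA ler_wpM2l// exprn_ge0 ?expR_ge0.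
Qed.
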